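(* Let $(M,g,S(TM),S(TM^\perp))$ be a QGCR-lightlike submanifold of an indefinite nearly Sasakian manifold $(\overline{M},\overline{\phi},\eta,\xi,\overline{g})$. Then the distribution $D=D_0\perp D_1$ is integrable if and only if $$h(P_1X,Y)+h(X,P_1Y)=2\big(Q\nabla_XY+f\,h(X,Y)+\overline{g}(X,Y)\xi_{\mathrm{tr}M}\big)\quad\text{and}\quad P_2[X,Y]=0$$ for all $X,Y\in\Gamma(D)$.
   Context: Notation: $\Gamma(\Xi)$ is the set of smooth sections of a vector bundle $\Xi$. Indefinite nearly Sasakian manifold: a $(2n+1)$-dimensional manifold $\overline{M}$ with a $(1,1)$-tensor $\overline{\phi}$, a vector field $\xi$, a 1-form $\eta$ and a semi-Riemannian metric $\overline{g}$ with Levi-Civita connection $\overline{\nabla}$ such that $\overline{\phi}^2=-I+\eta\otimes\xi$, $\eta(\xi)=1$, $\eta\circ\overline{\phi}=0$, $\overline{\phi}\xi=0$, $\overline{g}(\overline{\phi}X,\overline{\phi}Y)=\overline{g}(X,Y)-\eta(X)\eta(Y)$ (hence $\eta=\overline{g}(\xi,\cdot)$), and $(\overline{\nabla}_X\overline{\phi})Y+(\overline{\nabla}_Y\overline{\phi})X=2\overline{g}(X,Y)\xi-\eta(Y)X-\eta(X)Y$ for all $X,Y$. Lightlike submanifold: a submanifold $M$ of $\overline{M}$, with $g$ the induced (degenerate) metric, such that $\mathrm{Rad}\,TM=TM\cap TM^\perp$ is a smooth distribution of rank $r>0$. A screen distribution $S(TM)$ is a semi-Riemannian (non-degenerate) complement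 of $\mathrm{Rad}\,TM$ in $TM$; $S(TM^\perp)$ is a semi-Riemannian complement of $\mathrm{Rad}\,TM$ in $TM^\perp$. The lightlike transversal bundle $l\mathrm{tr}(TM)$ is locally spanned by null sections $N_i$ of the orthogonal complement of $S(TM^\perp)$ in $S(TM)^\perp$ with $\overline{g}(E_i,N_j)=\delta_{ij}$, $\overline g(N_i,N_j)=0$ for a local basis $\{E_i\}$ of $\mathrm{Rad}\,TM$. Put $\mathrm{tr}(TM)=l\mathrm{tr}(TM)\perp S(TM^\perp)$, so $T\overline{M}|_M=TM\oplus\mathrm{tr}(TM)=S(TM)\perp S(TM^\perp)\perp\{\mathrm{Rad}\,TM\oplus l\mathrm{tr}(TM)\}$. The Gauss formula is $\overline{\nabla}_XY=\nabla_XY+h(X,Y)$ for $X,Y\in\Gamma(TM)$, with $\nabla_XY\in\Gamma(TM)$ and $h(X,Y)\in\Gamma(\mathrm{tr}(TM))$. QGCR-lightlike submanifold: a lightlike submanifold $(M,g,S(TM),S(TM^\perp))$ of $\overline{M}$ is Quasi Generalized Cauchy-Riemann (QGCR) if (i) there are distributions $D_1,D_2$ of $\mathrm{Rad}\,TM$ with $\mathrm{Rad}\,TM=D_1\oplus D_2$, $\overline{\phi}D_1=D_1$, $\overline{\phi}D_2\subset S(TM)$; (ii) there are subbundles $D_0,\overline{D}$ of $S(TM)$ with $S(TM)=\{\overline{\phi}D_2\oplus\overline{D}\}\perp D_0$, $\overline{\phi}D_0\subseteq D_0$, $\overline{D}=\overline{\phi}\mathcal{S}\oplus\overline{\phi}\mathcal{L}$,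 where $D_0$ is non-degenerate and $\mathcal{L}$, $\mathcal{S}$ are vector subbundles of $l\mathrm{tr}(TM)$ and $S(TM^\perp)$ respectively. In (ii) the symbol $\oplus$ denotes a (not necessarily orthogonal) sum of subbundles, and the summands $\overline{\phi}D_2$ and $\overline{\phi}\mathcal{L}$ are allowed to intersect. Then $TM=D\oplus\widehat{D}$ with $D=D_0\perp D_1$ and $\widehat{D}=\{D_2\perp\overline{\phi}D_2\}\oplus\overline{D}$ (the latter sum in the same sense). Let $\pi,\widehat{\pi}$ be the projections of $TM$ onto $D$ and $\widehat{D}$. For $X\in\Gamma(TM)$: $P_1X=\overline{\phi}\pi X$; $P_2X$ is the tangential component (in $TM$) of $\overline{\phi}\widehat{\pi}X$; $QX$ is the transversal component (in $\mathrm{tr}(TM)$) of $\overline{\phi}X$; so $\overline{\phi}X=P_1X+P_2X+QX$. For $V\in\Gamma(\mathrm{tr}(TM))$, $\overline{\phi}V=tV+fV$ with $tV$ tangential and $fV$ transversal. $\xi_M$ and $\xi_{\mathrm{tr}M}$ are the tangential and transversal components of $\xi$ along $M$. *)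

(* Defs.v *)
From HB Require Import structures.
From mathcomp Require Import all_boot all_order all_algebra.
From mathcomp Require Import all_classical all_reals all_analysis.

Set Implicit Arguments.
Unset Strict Implicit.
Unset Printing Implicit Defensive.

Import Order.TTheory GRing.Theory Num.Theory.
Import numFieldNormedType.Exports.

Local Open Scope classical_set_scope.
Local Open Scope ring_scope.

Section Calculus.
Context {R : realType} {m : nat} {W : normedModType R}.

(* Only meant for open [U]. *)
Fixpoint Ck (k : nat) (U : set 'rV[R]_m) (F : 'rV[R]_m -> W) : Prop :=
  (forall x, U x -> {for x, continuous F}) /\
  if k is k'.+1 then
    forall j : 'I_m,
      (forall x, U x -> derivable F x (delta_mx 0 j)) /\
      Ck k' U (fun x => 'D_(delta_mx 0 j) F x)
  else True.

Definition Cinfty (U : set 'rV[R]_m) (F : 'rV[R]_m -> W) : Prop :=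
  forall k, Ck k U F.

End Calculus.

(* [cmap] and [cinv] are total; they are only meaningful on [cdom] and on
   [cmap @` cdom]. *)
Record chart (R : realType) (T : topologicalType) (m : nat) := Chart {
  cdom : set T;
  cmap :> T -> 'rV[R]_m;
  cinv : 'rV[R]_m -> T;
  cdom_open : open cdom;
  cimg_open : open (cmap @` cdom);
  cmapK : forall p, cdom p -> cinv (cmap p) = p;
  cmap_cont : forall p, cdom p -> {for p, continuous cmap};
  cinv_cont : forall x, (cmap @` cdom) x -> {for x, continuous cinv} }.

(* The atlas need not be maximal. [chart_at p] is a chosen chart around [p]:
   the tangent space at [p] is modelled on 'rV[R]_m, a vector being the row of
   its components in the coordinate frame of [chart_at p]. *)
Record manifold (R : realType) (m : nat) := Manifold {
  msort :> topologicalType;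
  atlas : set (chart R msort m);
  chart_at : msort -> chart R msort m;
  m_hausdorff : hausdorff_space msort;
  m_countable : @second_countable msort;
  chart_atP : forall p, atlas (chart_at p);
  chart_at_dom : forall p, cdom (chart_at p) p;
  atlas_compat : forall c c', atlas c -> atlas c' ->
    Cinfty (c @` (cdom c `&` cdom c')) (c' \o cinv c) }.

Section Manifolds.
Context {R : realType}.

Definition smooth_fun m (M : manifold R m) (W : normedModType R)
    (U : set M) (F : M -> W) : Prop :=
  forall c, atlas c -> Cinfty (c @` (U `&` cdom c)) (F \o cinv c).

Definition smooth_map m n (M : manifold R m) (N : manifold R n)
    (f : M -> N) : Prop :=
  continuous f /\
  forall c : chart R N n, atlas c -> smooth_fun (f @^-1` cdom c) (c \o f).

(* Derivative of [F] at [p] along the tangent vector [v]. *)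
Definition dfun m (M : manifold R m) (W : normedModType R)
    (F : M -> W) (p : M) (v : 'rV[R]_m) : W :=
  'D_v (F \o cinv (chart_at p)) (chart_at p p).

Definition tmap m n (M : manifold R m) (N : manifold R n)
    (f : M -> N) (p : M) : 'Hom('rV[R]_m, 'rV[R]_n) :=
  linfun ('d (chart_at (f p) \o f \o cinv (chart_at p)) (chart_at p p)).

(* Components of the tangent vector [v] at [p] in the chart [c]. *)
Definition tcoord m (M : manifold R m) (c : chart R M m)
    (p : M) (v : 'rV[R]_m) : 'rV[R]_m :=
  'd (c \o cinv (chart_at p)) (chart_at p p) v.

(* The coordinate field d/dx^k of the chart [c]. *)
Definition cframe m (M : manifold R m) (c : chart R M m) (k : 'I_m)
    (p : M) : 'rV[R]_m :=
  'd (chart_at p \o cinv c) (c p) (delta_mx 0 k).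

(* Smooth sections of f^*TN over the open set [U]. *)
Definition smooth_along m n (M : manifold R m) (N : manifold R n)
    (f : M -> N) (U : set M) (V : M -> 'rV[R]_n) : Prop :=
  forall c : chart R N n, atlas c ->
    smooth_fun (U `&` f @^-1` cdom c) (fun q => tcoord c (f q) (V q)).

Definition smooth_field m (M : manifold R m) (U : set M)
    (X : M -> 'rV[R]_m) : Prop :=
  smooth_along (fun p : M => p) U X.

(* X^j d_j Y - Y^j d_j X, computed in the chart [chart_at p]. *)
Definition lie_bracket m (M : manifold R m) (X Y : M -> 'rV[R]_m)
    (p : M) : 'rV[R]_m :=
  dfun (fun q => tcoord (chart_at p) q (Y q)) p (X p)
  - dfun (fun q => tcoord (chart_at p) q (X q)) p (Y p).

Definition smooth_subbundle m n (M : manifold R m) (N : manifold R n)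
    (f : M -> N) (k : nat) (D : M -> {vspace 'rV[R]_n}) : Prop :=
  (forall p, \dim (D p) = k) /\
  forall p, exists (U : set M) (s : 'I_k -> M -> 'rV[R]_n),
    [/\ open U, U p, forall a, smooth_along f U (s a)
      & forall q, U q -> D q = (\sum_(a < k) <[s a q]>)%VS].

(* [nb p v Y] is the derivative of [Y] along the tangent vector [v] at [p];
   it is defined on vector fields that are smooth around [p]. *)
Record connection m (M : manifold R m)
    (nb : forall p : M, 'rV[R]_m -> (M -> 'rV[R]_m) -> 'rV[R]_m) : Prop :=
  Connection {
    nb_smooth : forall U X Y, open U -> smooth_field U X -> smooth_field U Y ->
      smooth_field U (fun p => nb p (X p) Y);
    nb_local : forall U Y Y' p v, open U -> U p -> smooth_field U Y ->
      smooth_field U Y' -> (forall q, U q -> Y q = Y' q) ->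
      nb p v Y = nb p v Y';
    nb_linear : forall U Y p a v w, open U -> U p -> smooth_field U Y ->
      nb p (a *: v + w) Y = a *: nb p v Y + nb p w Y;
    nb_add : forall U Y Z p v, open U -> U p -> smooth_field U Y ->
      smooth_field U Z -> nb p v (fun q => Y q + Z q) = nb p v Y + nb p v Z;
    nb_leibniz : forall U (F : M -> R) Y p v, open U -> U p ->
      smooth_fun U F -> smooth_field U Y ->
      nb p v (fun q => F q *: Y q) = dfun F p v *: Y p + F p *: nb p v Y }.

(* The pulled-back connection of f^*TN, for f : M -> N: if V = V^k (d_k o f)
   around [p], with d_k the coordinate fields of [chart_at (f p)], then
   (f^* nb)_v V = v(V^k) d_k + V^k nb_{df v} d_k. *)
Definition pullback_conn m n (M : manifold R m) (N : manifold R n)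
    (f : M -> N) (nb : forall p : N, 'rV[R]_n -> (N -> 'rV[R]_n) -> 'rV[R]_n)
    (p : M) (v : 'rV[R]_m) (V : M -> 'rV[R]_n) : 'rV[R]_n :=
  let c := chart_at (f p) in
  dfun (fun q => tcoord c (f q) (V q)) p v
  + \sum_k V p 0 k *: nb (f p) (tmap f p v) (cframe c k).

Definition gform n (G : 'M[R]_n) (u v : 'rV[R]_n) : R := (u *m G *m v^T) 0 0.

Definition orth n (G : 'M[R]_n) (U : {vspace 'rV[R]_n}) : {vspace 'rV[R]_n} :=
  (\bigcap_(u <- vbasis U) lker (linfun (fun v => (gform G u v : R^o))))%VS.

Definition nondegenerate n (G : 'M[R]_n) (U : {vspace 'rV[R]_n}) : Prop :=
  (U :&: orth G U = 0)%VS.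

Definition negdef n (G : 'M[R]_n) (U : {vspace 'rV[R]_n}) : Prop :=
  forall u, u \in U -> u != 0 -> gform G u u < 0.

Definition has_index n (G : 'M[R]_n) (q : nat) : Prop :=
  (exists2 U, negdef G U & \dim U = q) /\
  (forall U, negdef G U -> (\dim U <= q)%N).

Record semi_riemannian m (M : manifold R m) (G : M -> 'M[R]_m) : Prop :=
  SemiRiemannian {
    sr_sym : forall p, (G p)^T = G p;
    sr_nondeg : forall p, G p \in unitmx;
    sr_index : exists q, forall p, has_index (G p) q;
    sr_smooth : forall U X Y, open U -> smooth_field U X -> smooth_field U Y ->
      smooth_fun U (fun p => gform (G p) (X p) (Y p)) }.

Record levi_civita m (M : manifold R m) (G : M -> 'M[R]_m)
    (nb : forall p : M, 'rV[R]_m -> (M -> 'rV[R]_m) -> 'rV[R]_m) : Prop :=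
  LeviCivita {
    lc_conn : connection nb;
    lc_torsion : forall U X Y p, open U -> U p ->
      smooth_field U X -> smooth_field U Y ->
      nb p (X p) Y - nb p (Y p) X = lie_bracket X Y p;
    lc_metric : forall U X Y p v, open U -> U p ->
      smooth_field U X -> smooth_field U Y ->
      dfun (fun q => gform (G q) (X q) (Y q)) p v
      = gform (G p) (nb p v X) (Y p) + gform (G p) (X p) (nb p v Y) }.

End Manifolds.

Record nearlySasakian (R : realType) (n : nat) (M : manifold R n.*2.+1) :=
  NearlySasakian {
    ns_phi : M -> 'End('rV[R]_(n.*2.+1));
    ns_xi : M -> 'rV[R]_(n.*2.+1);
    ns_eta : M -> 'Hom('rV[R]_(n.*2.+1), R^o);
    ns_g : M -> 'M[R]_(n.*2.+1);
    ns_nabla : forall p : M, 'rV[R]_(n.*2.+1) ->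
      (M -> 'rV[R]_(n.*2.+1)) -> 'rV[R]_(n.*2.+1);
    ns_phi_smooth : forall U X, open U -> smooth_field U X ->
      smooth_field U (fun p => ns_phi p (X p));
    ns_xi_smooth : smooth_field setT ns_xi;
    ns_eta_smooth : forall U X, open U -> smooth_field U X ->
      smooth_fun U (fun p => (ns_eta p (X p) : R));
    ns_riem : semi_riemannian ns_g;
    ns_lc : levi_civita ns_g ns_nabla;
    ns_phi2 : forall p v, ns_phi p (ns_phi p v) = - v + ns_eta p v *: ns_xi p;
    ns_eta_xi : forall p, ns_eta p (ns_xi p) = 1;
    ns_eta_phi : forall p v, ns_eta p (ns_phi p v) = 0;
    ns_phi_xi : forall p, ns_phi p (ns_xi p) = 0;
    ns_g_phi : forall p u v,
      gform (ns_g p) (ns_phi p u) (ns_phi p v)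
      = gform (ns_g p) u v - ns_eta p u * ns_eta p v;
    ns_nearly : forall U X Y p, open U -> U p ->
      smooth_field U X -> smooth_field U Y ->
      let nabla_phi (Z T : M -> 'rV[R]_(n.*2.+1)) :=
        ns_nabla p (Z p) (fun q => ns_phi q (T q))
        - ns_phi p (ns_nabla p (Z p) T) in
      nabla_phi X Y + nabla_phi Y X
      = (2 * gform (ns_g p) (X p) (Y p)) *: ns_xi p
        - ns_eta p (Y p) *: X p - ns_eta p (X p) *: Y p }.

(* [iota] is an injective immersion; the topology of M may be finer than the
   one induced by [iota]. *)
Record submanifold (R : realType) (m n : nat) (M : manifold R m)
    (N : manifold R n) (iota : M -> N) : Prop := Submanifold {
  sub_smooth : smooth_map iota;
  sub_inj : injective iota;
  sub_imm : forall p, lker (tmap iota p) = 0%VS }.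

Section Submanifolds.
Context {R : realType} {m n : nat} {M : manifold R m} {N : manifold R n}.
Variables (G : N -> 'M[R]_n) (iota : M -> N).

(* TM, TM^perp and Rad TM as subspaces of the tangent space of N at iota p. *)
Definition TM (p : M) : {vspace 'rV[R]_n} := limg (tmap iota p).
Definition TMperp (p : M) : {vspace 'rV[R]_n} := orth (G (iota p)) (TM p).
Definition RadTM (p : M) : {vspace 'rV[R]_n} := (TM p :&: TMperp p)%VS.

Record lightlike := Lightlike {
  ll_rank : nat;
  ll_STM : M -> {vspace 'rV[R]_n};
  ll_STMperp : M -> {vspace 'rV[R]_n};
  ll_ltr : M -> {vspace 'rV[R]_n};
  ll_rank_gt0 : (0 < ll_rank)%N;
  ll_rad_smooth : smooth_subbundle iota ll_rank RadTM;
  ll_STM_smooth : exists k, smooth_subbundle iota k ll_STM;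
  ll_STM_sum : forall p, (RadTM p + ll_STM p = TM p)%VS;
  ll_STM_cap : forall p, (RadTM p :&: ll_STM p = 0)%VS;
  ll_STM_nondeg : forall p, nondegenerate (G (iota p)) (ll_STM p);
  ll_STMperp_smooth : exists k, smooth_subbundle iota k ll_STMperp;
  ll_STMperp_sum : forall p, (RadTM p + ll_STMperp p = TMperp p)%VS;
  ll_STMperp_cap : forall p, (RadTM p :&: ll_STMperp p = 0)%VS;
  ll_STMperp_nondeg : forall p, nondegenerate (G (iota p)) (ll_STMperp p);
  ll_ltrP : forall p, exists (U : set M) (E B : 'I_ll_rank -> M -> 'rV[R]_n),
    [/\ open U, U p,
        forall a, smooth_along iota U (E a) /\ smooth_along iota U (B a)
      & forall q, U q ->
        [/\ RadTM q = (\sum_a <[E a q]>)%VS,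
            ll_ltr q = (\sum_a <[B a q]>)%VS,
            forall a, B a q \in (orth (G (iota q)) (ll_STM q)
                                 :&: orth (G (iota q)) (ll_STMperp q))%VS,
            forall a b, gform (G (iota q)) (E a q) (B b q) = (a == b)%:R
          & forall a b, gform (G (iota q)) (B a q) (B b q) = 0]] }.

End Submanifolds.

Section QGCR.
Context {R : realType} {n m : nat} {Mbar : manifold R n.*2.+1}.
Variables (NS : nearlySasakian Mbar) (M : manifold R m) (iota : M -> Mbar).
Variable L : lightlike (ns_g NS) iota.

Local Notation TN := 'rV[R]_(n.*2.+1).
Local Notation phi p := (ns_phi NS (iota p)).
Local Notation perp p := (orth (ns_g NS (iota p))).

(* Apart from Rad TM = D1 (+) D2 and the orthogonal splitting by D0, the sums
   of subbundles are not required to be direct. *)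
Record QGCR := MkQGCR {
  qD1 : M -> {vspace TN};
  qD2 : M -> {vspace TN};
  qD0 : M -> {vspace TN};
  qDbar : M -> {vspace TN};
  qL : M -> {vspace TN};
  qS : M -> {vspace TN};
  qD1_smooth : exists k, smooth_subbundle iota k qD1;
  qD2_smooth : exists k, smooth_subbundle iota k qD2;
  qD0_smooth : exists k, smooth_subbundle iota k qD0;
  qDbar_smooth : exists k, smooth_subbundle iota k qDbar;
  qL_smooth : exists k, smooth_subbundle iota k qL;
  qS_smooth : exists k, smooth_subbundle iota k qS;
  qRad_sum : forall p, RadTM (ns_g NS) iota p = (qD1 p + qD2 p)%VS;
  qRad_cap : forall p, (qD1 p :&: qD2 p = 0)%VS;
  q_phiD1 : forall p, (phi p @: qD1 p = qD1 p)%VS;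
  q_phiD2 : forall p, (phi p @: qD2 p <= ll_STM L p)%VS;
  qSTM_sum : forall p, ll_STM L p = ((phi p @: qD2 p + qDbar p) + qD0 p)%VS;
  qSTM_cap : forall p, ((phi p @: qD2 p + qDbar p) :&: qD0 p = 0)%VS;
  qSTM_orth : forall p, (phi p @: qD2 p + qDbar p <= perp p (qD0 p))%VS;
  q_phiD0 : forall p, (phi p @: qD0 p <= qD0 p)%VS;
  qDbarE : forall p, qDbar p = (phi p @: qS p + phi p @: qL p)%VS;
  qD0_nondeg : forall p, nondegenerate (ns_g NS (iota p)) (qD0 p);
  qL_sub : forall p, (qL p <= ll_ltr L p)%VS;
  qS_sub : forall p, (qS p <= ll_STMperp L p)%VS }.

Variable Q : QGCR.

Definition trTM (p : M) : {vspace TN} := (ll_ltr L p + ll_STMperp L p)%VS.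

(* Components along TM and tr(TM), in the tangent space of Mbar. *)
Definition tan_part (p : M) (v : TN) : TN :=
  daddv_pi (TM iota p) (trTM p) v.
Definition tr_part (p : M) (v : TN) : TN :=
  daddv_pi (trTM p) (TM iota p) v.

(* Sections of TM are vector fields X : M -> 'rV[R]_m. [push] and [pull] are
   the identification of T_pM with its image in the tangent space of Mbar. *)
Definition push (X : M -> 'rV[R]_m) (p : M) : TN := tmap iota p (X p).
Definition pull (V : M -> TN) (p : M) : 'rV[R]_m := ((tmap iota p)^-1)%VF (V p).

Definition nabla_bar (X : M -> 'rV[R]_m) (V : M -> TN) (p : M) : TN :=
  pullback_conn iota (ns_nabla NS) p (X p) V.

Definition nabla (X Y : M -> 'rV[R]_m) : M -> 'rV[R]_m :=
  pull (fun p => tan_part p (nabla_bar X (push Y) p)).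

Definition h (X Y : M -> 'rV[R]_m) (p : M) : TN :=
  tr_part p (nabla_bar X (push Y) p).

Definition distD (p : M) : {vspace TN} := (qD0 Q p + qD1 Q p)%VS.
Definition distDhat (p : M) : {vspace TN} :=
  ((qD2 Q p + phi p @: qD2 Q p) + qDbar Q p)%VS.

Definition P1 (X : M -> 'rV[R]_m) : M -> 'rV[R]_m :=
  pull (fun p => phi p (daddv_pi (distD p) (distDhat p) (push X p))).

Definition P2 (X : M -> 'rV[R]_m) : M -> 'rV[R]_m :=
  pull (fun p =>
    tan_part p (phi p (daddv_pi (distDhat p) (distD p) (push X p)))).

Definition Qop (X : M -> 'rV[R]_m) (p : M) : TN := tr_part p (phi p (push X p)).

Definition fop (V : M -> TN) (p : M) : TN := tr_part p (phi p (V p)).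

Definition xi_tr (p : M) : TN := tr_part p (ns_xi NS (iota p)).

Definition section_of (D : M -> {vspace TN}) (X : M -> 'rV[R]_m) : Prop :=
  smooth_field setT X /\ forall p, push X p \in D p.

(* Integrability in the sense of involutivity: [X, Y] is a section of D
   whenever X and Y are. Only the values of [X, Y] are constrained: the bracket
   of smooth fields is smooth. *)
Definition integrable_dist (D : M -> {vspace TN}) : Prop :=
  forall X Y, section_of D X -> section_of D Y ->
    forall p, push (lie_bracket X Y) p \in D p.

End QGCR.

(* Main.v *)
(* Apply the nearly Sasakian identity to X, Y in D and take transversal parts.
   Since phi X = P1 X on D and h is symmetric (the pulled-back connection is
   torsion free), this gives
     h(P1 X, Y) + h(X, P1 Y)
       = 2 (Q nabla_X Y + f h(X, Y) + g(X, Y) xi_tr) - tr (phi [X, Y]),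
   so the first condition says that phi [X, Y] is tangent. Together with
   P2 [X, Y] = 0 it says that phi kills the Dhat-component v of [X, Y], that is,
   v = eta(v) xi. Then eta(v) = 0: eta vanishes on the range of phi, the
   D2-component d2 of v is orthogonal to TM, which contains v, and so
   eta(v)^2 = eta(v) eta(d2) = g(v, d2) = 0.

   The connection is only given on fields of the ambient manifold, so sections
   along the submanifold are expanded in coordinate frames. This needs the chain
   rule, the smoothness of those frames and the symmetry of second derivatives
   for maps that are C^k in the sense of partial derivatives. *)
Require Import Defs.
From HB Require Import structures.
From mathcomp Require Import all_boot all_order all_algebra.
From mathcomp Require Import all_classical all_reals all_analysis.
From mathcomp Require Import ring.
Import Order.TTheory GRing.Theory Num.Theory.
Import numFieldNormedType.Exports.
Local Open Scope classical_set_scope.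
Local Open Scope ring_scope.

Set Implicit Arguments.
Unset Strict Implicit.
Unset Printing Implicit Defensive.

(** * Calculus in several variables *)

Section Calculus.
Context {R : realType}.

(** Two obstacles shape the work along the submanifold. First, [P1 X] is obtained from phi X by
    inverting the tangent map of [iota] point by point, so its regularity must be proved before the
    symmetry of h applies to the pair [P1 X], [Y]. Near a point the components of [P1 X] solve a
    linear system whose matrix is the Jacobian of [iota], of full rank because [iota] is an
    immersion. This yields differentiability at each point, and the calculus along [iota] asks for
    no more than that. Second, the nearly Sasakian identity is assumed for fields of the ambient
    manifold, while Y and phi Y live only along M. In nabla_X (phi Y) - phi (nabla_X Y) all
    derivatives of Y cancel, so each side of the identity is bilinear in the values of X and Y at
    the point, and it suffices to know it for the coordinate fields of one ambient chart. *)

Lemma differentiable_approx (V W : normedModType R) (f : V -> W)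
    (df : {linear V -> W}) (x : V) : continuous df ->
  (forall e, 0 < e -> \forall h \near 0, `|f (h + x) - f x - df h| <= e * `|h|) ->
  differentiable f x.
Proof.
move=> cdf H.
have E : f \o shift x = cst (f x) + df +o_0 id.
  apply/eqaddoP => e e0; near=> h.
  rewrite -[X in `|X|]/(f (h + x) - (f x + df h)) opprD addrA.
  by near: h; exact: H.
have D := diff_unique cdf E.
by apply/diff_locallyP; rewrite D.
Unshelve. all: by end_near. Qed.

Lemma is_derive_scale (V W : normedModType R) (f : V -> W) (x v : V) (c : R) l :
  is_derive x v f l -> is_derive x (c *: v) f (c *: l).
Proof.
move=> [dfx <-].
pose g (t : R) := f (t *: v + x).
have dg : differentiable g (c * 0).
  by rewrite mulr0; apply/derivable1_diffP; apply: (derivable1P _ _ _).1.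
have dc : differentiable (fun t : R => c * t) 0 by [].
have E : (fun t : R => f (t *: (c *: v) + x)) = g \o (fun t : R => c * t).
  by apply/funext => t /=; rewrite /g scalerA mulrC.
split.
  by apply/derivable1P/derivable1_diffP; rewrite E; exact: differentiable_comp.
have D1 (u : V) : 'D_u f x = 'D_1 (fun t : R => f (t *: u + x)) 0.
  rewrite /derive; set g1 := fun h : R => h^-1 *: _; set g2 := fun h : R => h^-1 *: _.
  suff -> : g1 = g2 by [].
  by rewrite funeqE /g1 /g2 => h /=; rewrite addr0 scale0r add0r [_%:A]mulr1.
rewrite !D1 E deriveE; last exact: differentiable_comp.
rewrite diff_comp// [in LHS]/comp.
have -> : 'd (fun t : R => c * t) 0 1 = c.
  by have [_ ->] := @is_diff_scaler R R c 0; exact: mulr1.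
rewrite mulr0 in dg *.
by rewrite [in RHS]deriveE// -linearZ /= [_ *: 1]mulr1.
Qed.

Lemma is_derive_line (V W : normedModType R) (f : V -> W) (y v : V) (s : R) l :
  is_derive (y + s *: v) v f l -> is_derive s 1 (fun t : R => f (y + t *: v)) l.
Proof.
move=> [d <-].
have E : (fun t : R => t^-1 *:
    (((fun t0 : R => f (y + t0 *: v)) \o shift s) (t *: 1) - f (y + s *: v))) =
   (fun t : R => t^-1 *: ((f \o shift (y + s *: v)) (t *: v) - f (y + s *: v))).
  apply/funext => t /=; congr (_ *: (f _ - _)).
  by rewrite [t%:A]mulr1 scalerDl addrCA.
by split; rewrite /derivable/derive E.
Qed.

Lemma is_derive_translate (V W : normedModType R) (f : V -> W) (y w u : V) l :
  is_derive (y + w) u f l -> is_derive y u (f \o shift w) l.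
Proof.
move=> [d <-].
have E : (fun h : R => h^-1 *:
    (((f \o shift w) \o shift y) (h *: u) - (f \o shift w) y)) =
   (fun h : R => h^-1 *: ((f \o shift (y + w)) (h *: u) - f (y + w))).
  by apply/funext => h /=; rewrite addrA.
by split; rewrite /derivable/derive E.
Qed.

Lemma MVT_dir (V : normedModType R) (f df : V -> R) (y v : V) :
  (forall s : R, 0 <= s <= 1 -> is_derive (y + s *: v) v f (df (y + s *: v))) ->
  exists2 s, 0 <= s <= 1 & f (y + v) - f y = df (y + s *: v).
Proof.
move=> H.
pose g (t : R) := f (y + t *: v).
have H' (s : R) : 0 <= s <= 1 -> is_derive s 1 g (df (y + s *: v)).
  by move=> /H /is_derive_line.
have [||c c01] := @MVT R g (fun s => df (y + s *: v)) 0 1 ltr01.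
- by move=> s; rewrite in_itv/= => /andP[/ltW s0 /ltW s1]; apply: H'; rewrite s0.
- apply: derivable_within_continuous => s; rewrite in_itv/= => /H' []//.
rewrite /g scale1r scale0r addr0 subr0 mulr1 => ->; exists c => //.
by move: c01; rewrite in_itv/= => /andP[/ltW -> /ltW ->].
Qed.

(* Young's theorem: only the differentiability of the two first derivatives
   at the point is needed. *)
Lemma derive_swap_limit (V : normedModType R) (f : V -> R) (x u v : V) :
  (\forall y \near x, derivable f y u) ->
  differentiable ('D_u f) x ->
  (fun t : R => (f (x + t *: u + t *: v) - f (x + t *: u)
     - f (x + t *: v) + f x) / t ^+ 2) @ 0^'+ --> 'D_v ('D_u f) x.
Proof.
move=> du ddu; apply/cvgrPdist_le => e e0.
(* [t * M] bounds the displacements [t v + s t u] and [s t u] at which ['D_u f] gets evaluated; the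
   summand 1 keeps [M] positive. With tolerance [e / 2 / M], each of the two remainders is at most
   [t * e / 2]. *)
pose M := `|u| + `|v| + 1.
have M0 : 0 < M by rewrite ltr_wpDl// addr_ge0.
have e'0 : 0 < e / 2 / M by rewrite !divr_gt0.
have [d1 /= d10 H1] : exists2 d : R, 0 < d & forall h, `|h| < d ->
   derivable f (x + h) u /\ `|'D_u f (x + h) - 'D_u f x - 'd ('D_u f) x h|
     <= e / 2 / M * `|h|.
  pose err := 'D_u f \o shift x - (cst ('D_u f x) + 'd ('D_u f) x).
  have A : \forall h \near (0 : V), `|err h| <= e / 2 / M * `|h|.
    by have /eqaddoP := diff_locally ddu; apply.
  have B : \forall h \near (0 : V), derivable f (x + h) u.
    move: du; rewrite (near_shift 0) subr0 => B; apply: filterS B => h /=.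
    by rewrite addrC.
  have /nbhs_norm0P[d /= d0 dH] : \forall h \near (0 : V),
      `|err h| <= e / 2 / M * `|h| /\ derivable f (x + h) u by apply: filterI.
  exists d => // h hd; have [/= a b] := dH h hd; split => //.
  move: a; rewrite -[err h]/('D_u f (h + x) - ('D_u f x + 'd ('D_u f) x h)).
  by rewrite opprD addrA [h + x]addrC.
near=> t.
have t0 : 0 < t by near: t; exact: nbhs_right_gt.
have tM : t * M < d1.
  rewrite -ltr_pdivlMr//; near: t; apply: nbhs_right_lt; exact: divr_gt0.
have small s : 0 <= s <= 1 ->
    `|t *: v + s *: (t *: u)| <= t * M /\ `|s *: (t *: u)| <= t * M.
  move=> /andP[s0 s1].
  have su : `|s *: (t *: u)| <= t * `|u|.
    by rewrite !normrZ (ger0_norm s0) (gtr0_norm t0) ler_piMl// mulr_ge0// ltW.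
  split; last by rewrite (le_trans su)// ler_pM2l// /M -addrA lerDl addr_ge0.
  rewrite (le_trans (ler_normD _ _))// normrZ (gtr0_norm t0).
  by rewrite (le_trans (lerD (lexx _) su))// -mulrDr ler_pM2l// /M addrC lerDl.
(* The second difference is the increment of [F] along [t u]. The mean value theorem turns it into a
   difference of two values of ['D_u f], and both are compared with the linear expansion of ['D_u f]
   at [x]. *)
pose F z := f (z + t *: v) - f z.
pose dF z := t * ('D_u f (z + t *: v) - 'D_u f z).
have [s s01 Hs] : exists2 s, 0 <= s <= 1 &
    F (x + t *: u) - F x = dF (x + s *: (t *: u)).
  apply: MVT_dir => s s01; have [n1 n2] := small s s01.
  have D1 : is_derive (x + s *: (t *: u)) (t *: u) f
      (t *: 'D_u f (x + s *: (t *: u))).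
    apply: is_derive_scale; apply: derivableP.
    by apply: (H1 _ _).1; exact: le_lt_trans n2 tM.
  have D2 : is_derive (x + s *: (t *: u)) (t *: u) (f \o shift (t *: v))
      (t *: 'D_u f (x + s *: (t *: u) + t *: v)).
    apply: is_derive_scale.
    apply: is_derive_translate; apply: derivableP.
    by rewrite -addrA [s *: _ + _]addrC; apply: (H1 _ _).1; exact: le_lt_trans n1 tM.
  have := is_deriveB D2 D1.
  by rewrite -scalerBr.
have -> : f (x + t *: u + t *: v) - f (x + t *: u) - f (x + t *: v) + f x =
    F (x + t *: u) - F x.
  by rewrite /F opprB addrA [in RHS]addrAC.
rewrite Hs /dF deriveE//.
have [n1 n2] := small s s01.
have [_] := H1 _ (le_lt_trans n1 tM); have [_] := H1 _ (le_lt_trans n2 tM).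
set a := 'd _ _; set w := s *: (t *: u).
rewrite -[in 'D_u f (x + w + _)]addrA [w + _]addrC.
set A := 'D_u f (x + (t *: v + w)); set B := 'D_u f (x + w).
set C := 'D_u f x => HB HA.
(* The contribution [q] of the unknown intermediate point [w] cancels between the two expansions, so
   the error is [t^-1] times a difference of two remainders. *)
have fld (p q A' B' C' : R) :
    p - t * (A' - B') / t ^+ 2 = t^-1 * ((B' - C' - q) - (A' - C' - (t * p + q))).
  by field; rewrite gt_eqF.
have av : a (t *: v + w) = t * a v + a w by rewrite linearD linearZ.
rewrite (fld _ (a w) A B C) -av.
rewrite normrM normfV (gtr0_norm t0) ler_pdivrMl//.
rewrite (le_trans (ler_normB _ _))//.
have E2 : t * e = e / 2 / M * (t * M) + e / 2 / M * (t * M) by field; rewrite gt_eqF.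
rewrite E2 lerD//.
  by rewrite (le_trans HB)// ler_pM2l.
by rewrite (le_trans HA)// ler_pM2l.
Unshelve. all: by end_near. Qed.

(** The quotient of [derive_swap_limit] is symmetric in [u] and [v], so both mixed derivatives are
    its limit. *)
Lemma derive_swap (V : normedModType R) (f : V -> R) (x u v : V) :
  (\forall y \near x, derivable f y u) -> (\forall y \near x, derivable f y v) ->
  differentiable ('D_u f) x -> differentiable ('D_v f) x ->
  'D_v ('D_u f) x = 'D_u ('D_v f) x.
Proof.
move=> du dv ddu ddv.
have A := derive_swap_limit (v := v) du ddu.
have B := derive_swap_limit (v := u) dv ddv.
apply: (cvg_unique _ A); first exact: norm_hausdorff.
suff -> : (fun t : R => (f (x + t *: u + t *: v) - f (x + t *: u)
     - f (x + t *: v) + f x) / t ^+ 2) =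
    (fun t : R => (f (x + t *: v + t *: u) - f (x + t *: v)
     - f (x + t *: u) + f x) / t ^+ 2) by [].
apply/funext => t; congr (_ / _).
by rewrite [x + _ + t *: v]addrAC [X in X + _]addrAC.
Qed.

Lemma row_continuousP (T : topologicalType) n (F : T -> 'rV[R]_n) (x : T) :
  {for x, continuous F} <-> forall i, {for x, continuous (fun y => F y 0 i)}.
Proof.
split=> [cF i|H].
  apply: (@continuous_comp _ _ _ F (fun M : 'rV[R]_n => M 0 i)) => //.
  exact: coord_continuous.
apply/cvgrPdist_le => e e0; near=> y.
rewrite /Num.Def.normr/= mx_normrE (bigmax_le _ (ltW e0))//= => -[a i] _ /=.
rewrite ord1 !mxE; move: i; near: y; apply: filter_forall => i.
by have /cvgrPdist_le := H i; apply.
Unshelve. all: by end_near. Qed.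

Lemma row_derivableP (V : normedModType R) n (F : V -> 'rV[R]_n) x v :
  derivable F x v <-> forall i, derivable (fun y => F y 0 i) x v.
Proof.
split=> [/derivable_mxP H i//|H]; apply/derivable_mxP => a i.
by rewrite ord1.
Qed.

Lemma derive_rowE (V : normedModType R) n (F : V -> 'rV[R]_n) x v i :
  derivable F x v -> ('D_v F x) 0 i = 'D_v (fun y => F y 0 i) x.
Proof. by move=> /derive_mx ->; rewrite mxE. Qed.

Lemma row_differentiable (V : normedModType R) n (F : V -> 'rV[R]_n) x :
  (forall i, differentiable (fun y => F y 0 i) x) -> differentiable F x.
Proof.
move=> H.
have -> : F = \sum_i (fun y => F y 0 i *: (delta_mx 0 i : 'rV[R]_n)).
  by apply/funext => y; rewrite fct_sumE [LHS]row_sum_delta.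
by apply: differentiable_sum => i; exact: differentiableZl.
Qed.

(** * Maps of class C^k in the sense of partial derivatives *)

Section Ck_theory.
Context {m : nat}.
Implicit Types (U : set 'rV[R]_m).

Local Notation "''e_' j" := (delta_mx 0 j : 'rV[R]_m) (at level 8, j at level 2).

Lemma Ck_continuous (W : normedModType R) k U (F : 'rV[R]_m -> W) x :
  Ck k U F -> U x -> {for x, continuous F}.
Proof. by case: k => [|k] [cF _]; exact: cF. Qed.

Lemma CkS (W : normedModType R) k U (F : 'rV[R]_m -> W) : Ck k.+1 U F -> Ck k U F.
Proof.
elim: k F => [|k IH] F [cF dF]; first by split.
split=> // j; have [d D] := dF j; split=> //; exact: IH.
Qed.

Lemma Ck_le (W : normedModType R) k l U (F : 'rV[R]_m -> W) :
  (l <= k)%N -> Ck k U F -> Ck l U F.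
Proof.
elim: k => [|k IH]; first by rewrite leqn0 => /eqP ->.
by rewrite leq_eqVlt => /orP[/eqP ->//|/IH {}IH /CkS].
Qed.

Lemma Ck_sub (W : normedModType R) k U U' (F : 'rV[R]_m -> W) :
  U' `<=` U -> Ck k U F -> Ck k U' F.
Proof.
move=> UU; elim: k F => [|k IH] F [cF dF].
  by split=> // x /UU; exact: cF.
split=> [x /UU /cF //|j]; have [d D] := dF j; split=> [x /UU /d//|].
exact: IH.
Qed.

(** On an open set, equality at all points is equality near each point, which passes to continuity,
    derivability and the derivatives themselves. *)
Lemma Ck_ext (W : normedModType R) k U (F G : 'rV[R]_m -> W) : open U ->
  (forall x, U x -> F x = G x) -> Ck k U F -> Ck k U G.
Proof.
move=> oU FG0; have near_eq (F' G' : 'rV[R]_m -> W) x :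
    (forall y, U y -> F' y = G' y) -> U x -> \forall y \near x, F' y = G' y.
  move=> FG Ux; have : \forall y \near x, U y by exact: open_nbhs_nbhs.
  by apply: filterS => y /FG.
have cont (F' G' : 'rV[R]_m -> W) x : (forall y, U y -> F' y = G' y) ->
    U x -> {for x, continuous F'} -> {for x, continuous G'}.
  move=> FG Ux; rewrite /continuous_at /prop_for -FG// => c.
  by apply: cvg_trans c; exact: (near_eq_cvg (near_eq F' G' x FG Ux)).
elim: k F G FG0 => [|k IH] F G FG [cF dF].
  by split=> // x Ux; apply: (cont F) => //; exact: cF.
split=> [x Ux|j]; first by apply: (cont F) => //; exact: cF.
have [d D] := dF j; split.
  by move=> x Ux; apply: near_eq_derivable (d x Ux); exact: near_eq.
by apply: IH D => x Ux; apply: near_eq_derive; exact: near_eq.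
Qed.

Lemma Ck_cst (W : normedModType R) k U (c : W) : Ck k U (fun=> c).
Proof.
have cc c' (x : 'rV[R]_m) : {for x, continuous (fun=> c' : W)} by exact: cst_continuous.
elim: k c => [|k IH] c; first by split => // x _; exact: cc.
split=> [x _|j]; first exact: cc.
split=> [x _|]; first exact: derivable_cst.
have -> : (fun x : 'rV[R]_m => 'D_('e_j) (fun=> c : W) x) = fun=> 0.
  by apply/funext => x; exact: derive_cst.
exact: IH.
Qed.

Lemma CkD (W : normedModType R) k U (F G : 'rV[R]_m -> W) : open U ->
  Ck k U F -> Ck k U G -> Ck k U (fun x => F x + G x).
Proof.
move=> oU; elim: k F G => [|k IH] F G [cF dF] [cG dG].
  by split=> // x Ux; apply: continuousD; [exact: cF|exact: cG].
split=> [x Ux|j]; first by apply: continuousD; [exact: cF|exact: cG].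
have [d D] := dF j; have [d' D'] := dG j; split=> [x Ux|].
  by apply: derivableD; [exact: d|exact: d'].
apply: (Ck_ext oU) (IH _ _ D D') => x Ux.
by rewrite deriveD//; [exact: d|exact: d'].
Qed.

Lemma Ck_sum (W : normedModType R) k U n (F : 'I_n -> 'rV[R]_m -> W) : open U ->
  (forall i, Ck k U (F i)) -> Ck k U (fun x => \sum_i F i x).
Proof.
move=> oU H; elim: n F H => [|n IH] F H.
  by under eq_fun do rewrite big_ord0; exact: Ck_cst.
by under eq_fun do rewrite big_ord_recr/=; apply: CkD => //; exact: IH.
Qed.

Lemma CkM k U (F G : 'rV[R]_m -> R) : open U ->
  Ck k U F -> Ck k U G -> Ck k U (fun x => F x * G x).
Proof.
move=> oU; elim: k F G => [|k IH] F G cdF cdG;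
  have [cF dF] := cdF; have [cG dG] := cdG.
  by split=> // x Ux; apply: continuousM; [exact: cF|exact: cG].
split=> [x Ux|j]; first by apply: continuousM; [exact: cF|exact: cG].
have [d D] := dF j; have [d' D'] := dG j; split=> [x Ux|].
  by apply: derivableM; [exact: d|exact: d'].
apply: (Ck_ext oU) (CkD oU (IH _ _ (CkS cdF) D') (IH _ _ (CkS cdG) D)) => x Ux.
by rewrite deriveM//; [exact: d|exact: d'].
Qed.

Lemma Ck_rowP n k U (F : 'rV[R]_m -> 'rV[R]_n) : open U ->
  Ck k U F <-> forall i, Ck k U (fun x => F x 0 i).
Proof.
move=> oU; elim: k F => [|k IH] F.
  split=> [[cF _] i|H].
    by split=> // x Ux; move/row_continuousP: (cF x Ux).
  by split=> // x Ux; apply/row_continuousP => i; have [c _] := H i; exact: c.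
split=> [[cF dF] i|H].
  split=> [x Ux|j]; first by move/row_continuousP: (cF x Ux).
  have [d D] := dF j; split=> [x Ux|].
    by move/row_derivableP: (d x Ux).
  move/IH: D => /(_ i); apply: (Ck_ext oU) => x Ux.
  by rewrite derive_rowE//; exact: d.
have d j x : U x -> derivable F x 'e_j.
  by move=> Ux; apply/row_derivableP => i; have [_ /(_ j)[d _]] := H i; exact: d.
split=> [x Ux|j].
  by apply/row_continuousP => i; have [c _] := H i; exact: c.
split=> [x|]; first exact: d.
apply/IH => i; have [_ /(_ j)[_]] := H i; apply: (Ck_ext oU) => x Ux.
by rewrite derive_rowE//; exact: d.
Qed.

Lemma coord_le_norm n (h : 'rV[R]_n) i : `|h 0 i| <= `|h|.
Proof.
rewrite [leRHS]/Num.Def.normr/= mx_normrE.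
exact: (le_bigmax _ (fun ij => `|h ij.1 ij.2|) (0, i)).
Qed.

Lemma norm_le_coord n (h : 'rV[R]_n) (c : R) : 0 <= c ->
  (forall i, `|h 0 i| <= c) -> `|h| <= c.
Proof.
move=> c0 H; rewrite [leLHS]/Num.Def.normr/= mx_normrE bigmax_le// => -[a i] _ /=.
by rewrite ord1.
Qed.

Lemma continuous_rowlin (W : normedModType R) (f : {linear 'rV[R]_m -> W}) :
  continuous f.
Proof.
have E : (f : _ -> _) = \sum_i (fun y : 'rV[R]_m => y 0 i *: f 'e_i).
  apply/funext => y; rewrite fct_sumE [in LHS](row_sum_delta y) linear_sum.
  by apply: eq_bigr => i _; rewrite linearZ.
move=> x; rewrite E; apply: differentiable_continuous.
apply: (@differentiable_sum _ _ _ m (fun i (y : 'rV[R]_m) => y 0 i *: f 'e_i)) => i.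
by apply: differentiableZl; exact: differentiable_coord.
Qed.

(* Interpolate between [x] and [x + h] by changing one coordinate at a time,
   and apply the mean value theorem to each step. *)
Lemma C1_differentiable U (F : 'rV[R]_m -> R) x : open U -> Ck 1 U F -> U x ->
  differentiable F x.
Proof.
move=> oU [cF dF] Ux.
pose D (h : 'rV[R]_m) : R := \sum_i h 0 i * 'D_('e_i) F x.
have Dlin : linear D.
  move=> a u v; rewrite /D scaler_sumr -big_split/=; apply: eq_bigr => i _.
  by rewrite !mxE mulrDl -mulrA.
pose DL : {linear 'rV[R]_m -> R} := HB.pack D (GRing.isLinear.Build _ _ _ _ _ Dlin).
apply: (@differentiable_approx _ _ _ DL); first exact: continuous_rowlin.
move=> e e0.
(* There are [m] coordinate steps, each contributing at most this multiple of the norm of [h].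
   Dividing by [m.+1] rather than [m] also covers dimension 0. *)
have e'0 : 0 < e / m.+1%:R by rewrite divr_gt0.
have /nbhs_norm0P[d /= d0 dH] : \forall h \near (0 : 'rV[R]_m), U (x + h) /\
    forall i, `|'D_('e_i) F (x + h) - 'D_('e_i) F x| <= e / m.+1%:R.
  have A : \forall y \near x, U y /\
      forall i, `|'D_('e_i) F y - 'D_('e_i) F x| <= e / m.+1%:R.
    near=> y; split; first by near: y; exact: open_nbhs_nbhs.
    move=> i; move: i; near: y; apply: filter_forall => i; have [_ [c _]] := dF i.
    have /cvgrPdist_le/(_ _ e'0) := c x Ux.
    by apply: filterS => y; rewrite distrC.
  by move: A; rewrite (near_shift 0) subr0; apply: filterS => h /=; rewrite addrC.
have nd : \forall h \near (0 : 'rV[R]_m), `|h| < d by apply/nbhs_norm0P; exists d.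
near=> h.
have hd : `|h| < d by near: h; exact: nd.
pose hk k : 'rV[R]_m := \row_i (if (i < k)%N then h 0 i else 0).
have hk0 : hk 0 = 0 by apply/rowP => i; rewrite !mxE.
have hkm : hk m = h by apply/rowP => i; rewrite !mxE ltn_ord.
have hkS (k : 'I_m) : hk k.+1 = hk k + h 0 k *: 'e_k.
  apply/rowP => i; rewrite !mxE eqxx/= ltnS leq_eqVlt.
  have [->|ik] := eqVneq i k; first by rewrite eqxx ltnn add0r mulr1.
  by rewrite (inj_eq val_inj) (negbTE ik)/= mulr0 addr0.
have tele : F (h + x) - F x = \sum_(k < m) (F (x + hk k.+1) - F (x + hk k)).
  rewrite -(big_mkord xpredT (fun k => F (x + hk k.+1) - F (x + hk k))).
  by rewrite (telescope_sumr (fun k => F (x + hk k)))// hkm hk0 addr0 [x + h]addrC.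
rewrite tele -sumrB.
have step (k : 'I_m) : `|F (x + hk k.+1) - F (x + hk k) - h 0 k * 'D_('e_k) F x|
    <= e / m.+1%:R * `|h|.
  pose v : 'rV[R]_m := h 0 k *: 'e_k.
  (* The norm is the maximum of the coordinates, and each coordinate of an intermediate point is
     bounded by the corresponding one of [h]; so the path stays in the ball. *)
  have small (s : R) : 0 <= s <= 1 -> `|hk k + s *: v| < d.
    move=> /andP[s0 s1]; apply: le_lt_trans hd; apply: norm_le_coord => // i.
    rewrite !mxE eqxx/=; have [->|ik] := eqVneq i k.
      rewrite ltnn add0r mulr1 normrM (ger0_norm s0).
      by rewrite (le_trans (ler_piMl _ s1))// coord_le_norm.
    rewrite mulr0 mulr0 addr0; case: ifP => _; last by rewrite normr0.
    exact: coord_le_norm.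
  have [s s01 ->] : exists2 s : R, 0 <= s <= 1 & F (x + hk k.+1) - F (x + hk k) =
      h 0 k * 'D_('e_k) F (x + hk k + s *: v).
    rewrite hkS -/v addrA.
    apply: (@MVT_dir _ F (fun y => h 0 k * 'D_('e_k) F y)) => s s01.
    apply: is_derive_scale; apply: derivableP; rewrite -addrA.
    by have [d' _] := dF k; apply: d'; exact: (dH _ (small s s01)).1.
  rewrite -mulrBr normrM mulrC -addrA.
  apply: ler_pM => //; last exact: coord_le_norm.
  exact: ((dH _ (small s s01)).2 k).
rewrite (le_trans (ler_norm_sum _ _ _))//.
rewrite (le_trans (ler_sum _ (fun k _ => step k)))//.
rewrite sumr_const card_ord -[leLHS]mulr_natl mulrA ler_wpM2r//.
by rewrite mulrCA ger_pMr// ler_pdivrMr// mul1r ler_nat leqnSn.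
Unshelve. all: by end_near. Qed.

Lemma C1_row_differentiable n U (F : 'rV[R]_m -> 'rV[R]_n) x : open U ->
  Ck 1 U F -> U x -> differentiable F x.
Proof.
move=> oU /(Ck_rowP _ _ oU) H Ux; apply: row_differentiable => i.
exact: (C1_differentiable oU (H i)).
Qed.

Lemma derive_row_sum (W : normedModType R) (F : 'rV[R]_m -> W) x v :
  differentiable F x -> 'D_v F x = \sum_i v 0 i *: 'D_('e_i) F x.
Proof.
move=> d; rewrite deriveE// [in LHS](row_sum_delta v) linear_sum.
by apply: eq_bigr => i _; rewrite linearZ deriveE.
Qed.

(** [Ck] only speaks of coordinate directions; differentiability makes any directional derivative a
    combination of the partial ones with constant coefficients. *)
Lemma Ck_derive k U (F : 'rV[R]_m -> R) v : open U ->
  Ck k.+1 U F -> Ck k U (fun x => 'D_v F x).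
Proof.
move=> oU CF; apply: (@Ck_ext _ _ _ (fun x => \sum_i v 0 i * 'D_('e_i) F x)) => //.
  move=> x Ux; rewrite derive_row_sum//.
  exact: (C1_differentiable oU (Ck_le _ CF)).
by apply: Ck_sum => // i; apply: CkM => //; [exact: Ck_cst|have [_ /(_ i)[]] := CF].
Qed.

Lemma Ck_row_derive n k U (F : 'rV[R]_m -> 'rV[R]_n) v : open U ->
  Ck k.+1 U F -> Ck k U (fun x => 'D_v F x).
Proof.
move=> oU CF; apply/(Ck_rowP _ _ oU) => i.
move/(Ck_rowP _ _ oU): (CF) => /(_ i)/(Ck_derive v oU).
apply: Ck_ext => // x Ux; rewrite derive_rowE//; apply: diff_derivable.
exact: (C1_row_differentiable oU (Ck_le _ CF)).
Qed.

Lemma C2_derive_swap n U (F : 'rV[R]_m -> 'rV[R]_n) x u v : open U -> U x ->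
  Ck 2 U F -> 'D_v ('D_u F) x = 'D_u ('D_v F) x.
Proof.
move=> oU Ux CF.
have CD w := Ck_row_derive w oU CF.
have dD w z : derivable ('D_w F) x z.
  exact/diff_derivable/(C1_row_differentiable oU (CD w)).
have dF y : U y -> differentiable F y by apply: C1_row_differentiable => //; exact: CkS.
have nU : \forall y \near x, U y by exact: open_nbhs_nbhs.
have E w z i : 'D_z (fun y => 'D_w F y 0 i) x =
    'D_z (fun y => 'D_w (fun t => F t 0 i) y) x.
  apply: near_eq_derive; apply: filterS nU => y Uy.
  by rewrite derive_rowE//; exact/diff_derivable/dF.
apply/rowP => i.
apply: etrans (derive_rowE i (dD u v)) _.
apply: etrans (esym (derive_rowE i (dD v u))).
apply: etrans (E u v i) _; apply: etrans (esym (E v u i)).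
have CFi := (Ck_rowP _ _ oU).1 CF i.
apply: derive_swap.
- by apply: filterS nU => y Uy; apply/diff_derivable/(C1_differentiable oU (CkS CFi)).
- by apply: filterS nU => y Uy; apply/diff_derivable/(C1_differentiable oU (CkS CFi)).
- exact: (C1_differentiable oU (Ck_derive _ oU CFi)).
- exact: (C1_differentiable oU (Ck_derive _ oU CFi)).
Qed.

End Ck_theory.

(** By the chain rule a partial derivative of the composite is a sum of products of partials of [g]
    with partials of [F] composed with [g]. The induction is generalised over [F] so that it applies
    to these partials. *)
Lemma Ck_comp m n k (U : set 'rV[R]_n) (V : set 'rV[R]_m) (F : 'rV[R]_n -> R)
    (g : 'rV[R]_m -> 'rV[R]_n) : open U -> open V -> (forall x, V x -> U (g x)) ->
  Ck k U F -> Ck k V g -> Ck k V (F \o g).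
Proof.
move=> oU oV gVU; elim: k F => [|k IH] F CF Cg.
  split=> // x Vx; apply: continuous_comp; first exact: (Ck_continuous Cg).
  by apply: (Ck_continuous CF); exact: gVU.
have dF x : V x -> differentiable F (g x).
  by move=> /gVU; apply: C1_differentiable => //; exact: Ck_le CF.
have dg x : V x -> differentiable g x.
  by apply: C1_row_differentiable => //; exact: Ck_le Cg.
split=> [x Vx|j].
  exact/differentiable_continuous/differentiable_comp/dF/Vx/dg.
split=> [x Vx|].
  exact/diff_derivable/differentiable_comp/dF/Vx/dg.
apply: (@Ck_ext _ _ _ _ (fun x => \sum_i ('D_(delta_mx 0 j) g x) 0 i *
    ('D_(delta_mx 0 i) F \o g) x)) => //.
  move=> x Vx; have dFg := differentiable_comp (dg x Vx) (dF x Vx).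
  rewrite [RHS]deriveE//.
  rewrite diff_comp; [|exact: dg|exact: dF].
  rewrite [RHS]/= -deriveE; last exact: dF.
  rewrite (derive_row_sum _ (dF x Vx)).
  by rewrite -deriveE//; exact: dg.
apply: Ck_sum => // i; apply: CkM => //.
  by have [_ /(_ j)[_]] := Cg => /(Ck_rowP _ _ oV).
by apply: IH; [have [_ /(_ i)[]] := CF|exact: CkS].
Qed.

Lemma Ck_row_comp m n l k (U : set 'rV[R]_n) (V : set 'rV[R]_m)
    (F : 'rV[R]_n -> 'rV[R]_l) (g : 'rV[R]_m -> 'rV[R]_n) :
  open U -> open V -> (forall x, V x -> U (g x)) ->
  Ck k U F -> Ck k V g -> Ck k V (F \o g).
Proof.
move=> oU oV gVU /(Ck_rowP _ _ oU) CF Cg; apply/(Ck_rowP _ _ oV) => i.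
exact: (Ck_comp oU oV gVU (CF i) Cg).
Qed.

End Calculus.

(** * Charts and coordinate frames *)

Section Charts.
Context {R : realType}.

Lemma near_eq_differentiable (V W : normedModType R) (f g : V -> W) x :
  (\forall y \near x, f y = g y) -> differentiable f x -> differentiable g x.
Proof.
move=> fg df; apply: (@differentiable_approx _ _ _ _ ('d f x)).
  exact: diff_continuous.
move=> e e0.
have A : \forall h \near (0:V), `|(f \o shift x - (cst (f x) + 'd f x)) h| <= e * `|h|.
  by have /eqaddoP := diff_locally df; apply.
have B : \forall h \near (0:V), f (h + x) = g (h + x).
  by move: fg; rewrite (near_shift 0) subr0; apply: filterS => h.
near=> h.
rewrite -(near B h)// -(nbhs_singleton fg).
have : `|(f \o shift x - (cst (f x) + 'd f x)) h| <= e * `|h| by near: h.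
by rewrite -[X in `|X|]/(f (h + x) - (f x + 'd f x h)) opprD addrA.
Unshelve. all: by end_near. Qed.

Lemma near_eq_diff (V W : normedModType R) (f g : V -> W) x v :
  (\forall y \near x, f y = g y) -> differentiable f x -> 'd g x v = 'd f x v.
Proof.
move=> fg df; have dg := near_eq_differentiable fg df.
by rewrite -!deriveE//; apply/esym/near_eq_derive.
Qed.

(** The chain rule in the form needed for charts: inserting a chart and its inverse changes nothing
    near the base point only, and the intermediate base points agree only after a rewriting. *)
Lemma diff_near_comp (U V W : normedModType R) (f : U -> V) (g : V -> W)
    (k : U -> W) x z v :
  f x = z -> differentiable f x -> differentiable g z ->
  (\forall y \near x, k y = g (f y)) -> 'd k x v = 'd g z ('d f x v).
Proof.
move=> <- df dg E; rewrite (@near_eq_diff _ _ (g \o f)).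
- by rewrite diff_comp.
- by apply: filterS E.
- exact: differentiable_comp.
Qed.

Lemma cinvK (T : topologicalType) m (c : chart R T m) x :
  (c @` cdom c) x -> c (cinv c x) = x.
Proof. by move=> [p cp <-]; rewrite cmapK. Qed.

Lemma chart_img_open (T : topologicalType) m (c : chart R T m) (U : set T) :
  open U -> open (c @` (U `&` cdom c)).
Proof.
move=> oU; have -> : c @` (U `&` cdom c) = [set x | (c @` cdom c) x /\ U (cinv c x)].
  apply/seteqP; split=> [_ [p [Up cp] <-]|x [[p cp <-] Ux]] /=.
    by rewrite cmapK//; split=> //; exists p.
  by exists p => //; split=> //; rewrite cmapK in Ux.
rewrite openE => x [cx Ux]; apply: filterI.
  by apply: open_nbhs_nbhs; split => //; exact: cimg_open.
have /= := cinv_cont cx; apply.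
exact: open_nbhs_nbhs.
Qed.

Lemma near_chart (T : topologicalType) m (c : chart R T m) (U : set T) p :
  open U -> U p -> cdom c p -> \forall x \near c p, U (cinv c x) /\ cdom c (cinv c x).
Proof.
move=> oU Up cp; have : \forall x \near c p, (c @` (U `&` cdom c)) x.
  by apply: open_nbhs_nbhs; split; [exact: chart_img_open|exists p].
by apply: filterS => _ [q [Uq cq] <-]; rewrite cmapK.
Qed.

(** * Tangent coordinates, coordinate fields and smooth fields *)

Section Manifold.
Context {m : nat} {M : manifold R m}.
Implicit Types (c : chart R M m) (p q : M).

Lemma transition_differentiable c c' p : atlas c -> atlas c' -> cdom c p -> cdom c' p ->
  differentiable (c' \o cinv c) (c p).
Proof.
move=> ac ac' cp cp'.
apply: (@C1_row_differentiable _ _ _ (c @` (cdom c `&` cdom c'))).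
- by rewrite setIC; apply: chart_img_open; exact: cdom_open.
- exact: atlas_compat.
- by exists p.
Qed.

Lemma tcoord_change c c' p v : atlas c -> atlas c' -> cdom c p -> cdom c' p ->
  tcoord c' p v = 'd (c' \o cinv c) (c p) (tcoord c p v).
Proof.
move=> ac ac' cp cp'; rewrite /tcoord.
have ap := chart_atP p; have dp := chart_at_dom p.
have e : (c \o cinv (chart_at p)) (chart_at p p) = c p by rewrite /= cmapK.
apply: diff_near_comp => //.
- exact: transition_differentiable.
- exact: transition_differentiable.
- have := near_chart (cdom_open c) cp dp; apply: filterS => x [cx _].
  by rewrite /= cmapK.
Qed.

Lemma diff_chart_id c p v : cdom c p -> 'd (c \o cinv c) (c p) v = v.
Proof.
move=> cp; rewrite (@near_eq_diff _ _ id).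
- by have [_ ->] := is_diff_id (c p).
- have : \forall x \near c p, (c @` cdom c) x.
    by apply: open_nbhs_nbhs; split; [exact: cimg_open|exists p].
  by apply: filterS => x cx /=; rewrite cinvK.
- by [].
Qed.

Lemma tcoord_chart_at p v : tcoord (chart_at p) p v = v.
Proof. by rewrite /tcoord diff_chart_id//; exact: chart_at_dom. Qed.

Lemma cframe_chart_at p k : cframe (chart_at p) k p = delta_mx 0 k.
Proof. by rewrite /cframe diff_chart_id//; exact: chart_at_dom. Qed.

Lemma tcoord_cframe c c' p k : atlas c -> atlas c' -> cdom c p -> cdom c' p ->
  tcoord c' p (cframe c k p) = 'D_(delta_mx 0 k) (c' \o cinv c) (c p).
Proof.
move=> ac ac' cp cp'.
have ap := chart_atP p; have dp := chart_at_dom p.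
rewrite deriveE; last exact: transition_differentiable.
rewrite /tcoord /cframe.
have e : (chart_at p \o cinv c) (c p) = chart_at p p by rewrite /= cmapK.
apply/esym/diff_near_comp => //.
- exact: transition_differentiable.
- exact: transition_differentiable.
- have := near_chart (cdom_open (chart_at p)) dp cp; apply: filterS => x [cx _].
  by rewrite /= cmapK.
Qed.

Lemma tcoord_cframe_id c p k : atlas c -> cdom c p ->
  tcoord c p (cframe c k p) = delta_mx 0 k.
Proof.
move=> ac cp; rewrite tcoord_cframe// deriveE; last exact: transition_differentiable.
exact: diff_chart_id.
Qed.

Lemma frame_expand c p v : atlas c -> cdom c p ->
  v = \sum_k (tcoord c p v) 0 k *: cframe c k p.
Proof.
move=> ac cp.
have ap := chart_atP p; have dp := chart_at_dom p.
transitivity ('d (chart_at p \o cinv c) (c p) (tcoord c p v)).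
  by rewrite -tcoord_change// tcoord_chart_at.
rewrite {1}[tcoord c p v]row_sum_delta linear_sum.
by apply: eq_bigr => k _; rewrite linearZ.
Qed.

Lemma tcoordD c p v w : tcoord c p (v + w) = tcoord c p v + tcoord c p w.
Proof. by rewrite /tcoord linearD. Qed.

Lemma tcoordZ c p a v : tcoord c p (a *: v) = a *: tcoord c p v.
Proof. by rewrite /tcoord linearZ. Qed.

Lemma tcoord_sum c p n (v : 'I_n -> 'rV[R]_m) :
  tcoord c p (\sum_i v i) = \sum_i tcoord c p (v i).
Proof. by rewrite /tcoord linear_sum. Qed.

Lemma smooth_fun_row_differentiable n (U : set M) (F : M -> 'rV[R]_n) c p :
  open U -> smooth_fun U F -> atlas c -> U p -> cdom c p ->
  differentiable (F \o cinv c) (c p).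
Proof.
move=> oU sF ac Up cp.
apply: (@C1_row_differentiable _ _ _ (c @` (U `&` cdom c))).
- exact: chart_img_open.
- exact: sF.
- by exists p.
Qed.

Lemma smooth_fun_coord n (U : set M) (F : M -> 'rV[R]_n) i :
  open U -> smooth_fun U F -> smooth_fun U (fun q => F q 0 i).
Proof.
move=> oU sF c ac k.
by apply: (Ck_rowP _ _ _).1 (sF c ac k) i; exact: chart_img_open.
Qed.

Lemma smooth_fieldD (U : set M) (X Y : M -> 'rV[R]_m) : open U ->
  smooth_field U X -> smooth_field U Y -> smooth_field U (fun q => X q + Y q).
Proof.
move=> oU sX sY c ac c' ac' k.
have o : open (c' @` ((U `&` id @^-1` cdom c) `&` cdom c')).
  by apply/chart_img_open/openI => //; exact: cdom_open.
apply: (Ck_ext o) (CkD o (sX c ac c' ac' k) (sY c ac c' ac' k)) => x _ /=.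
by rewrite tcoordD.
Qed.

Lemma smooth_fieldZ (U : set M) (F : M -> R) (Y : M -> 'rV[R]_m) : open U ->
  smooth_fun U F -> smooth_field U Y -> smooth_field U (fun q => F q *: Y q).
Proof.
move=> oU sF sY c ac c' ac' k.
have o : open (c' @` ((U `&` id @^-1` cdom c) `&` cdom c')).
  by apply/chart_img_open/openI => //; exact: cdom_open.
apply/(Ck_rowP _ _ o) => i.
have sFc : Ck k (c' @` ((U `&` id @^-1` cdom c) `&` cdom c')) (F \o cinv c').
  apply: Ck_sub (sF c' ac' k) => _ [q [[Uq _] cq] <-].
  by exists q.
have := (Ck_rowP _ _ o).1 (sY c ac c' ac' k) i.
move=> /(CkM o sFc); apply: (Ck_ext o) => x _ /=.
by rewrite tcoordZ mxE.
Qed.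

Lemma smooth_field0 (U : set M) : smooth_field U (fun=> 0).
Proof.
move=> c ac c' ac' k; rewrite (_ : _ \o _ = fun=> 0); first exact: Ck_cst.
by apply/funext => x /=; rewrite /tcoord linear0.
Qed.

Lemma smooth_field_sub (U U' : set M) (X : M -> 'rV[R]_m) :
  U' `<=` U -> smooth_field U X -> smooth_field U' X.
Proof.
move=> UU sX c ac c' ac' k; apply: Ck_sub (sX c ac c' ac' k) => _ [q [[Uq a] b] <-].
by exists q => //; split=> //; split=> //; exact: UU.
Qed.

Lemma smooth_field_tcoord (U : set M) (X : M -> 'rV[R]_m) c : open U ->
  smooth_field U X -> atlas c -> smooth_fun (U `&` cdom c) (fun q => tcoord c q (X q)).
Proof. by move=> oU sX ac; exact: sX. Qed.

(** Read in a chart [c'], the coordinate field is a partial derivative of the transition map from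
    [c] to [c']; the derivative it costs is harmless because transition maps are smooth of every
    order. *)
Lemma smooth_cframe c k : atlas c -> smooth_field (cdom c) (cframe c k).
Proof.
move=> ac c' ac' c'' ac'' l.
have o1 : open (cdom c `&` cdom c') by apply: openI; exact: cdom_open.
have o : open (c'' @` ((cdom c `&` cdom c') `&` cdom c'')) by exact: chart_img_open.
have o' : open (c @` (cdom c `&` cdom c')).
  by rewrite setIC; apply: chart_img_open; exact: cdom_open.
have D : Ck l (c @` (cdom c `&` cdom c')) (fun x => 'D_(delta_mx 0 k) (c' \o cinv c) x).
  exact: (Ck_row_derive (delta_mx 0 k) o' (atlas_compat ac ac' l.+1)).
have C : Ck l (c'' @` ((cdom c `&` cdom c') `&` cdom c'')) (c \o cinv c'').
  apply: Ck_sub (atlas_compat ac'' ac l) => _ [q [[cq _] cq''] <-].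
  by exists q.
have H x : (c'' @` ((cdom c `&` cdom c') `&` cdom c'')) x ->
    (c @` (cdom c `&` cdom c')) ((c \o cinv c'') x).
  by move=> [q [[cq cq'] cq''] <-] /=; rewrite cmapK//; exists q.
apply: (Ck_ext o) (Ck_row_comp o' o H D C) => _ [q [[cq cq'] cq''] <-] /=.
by rewrite cmapK// tcoord_cframe.
Qed.

End Manifold.

(** * Connections in coordinate frames *)

Section Connection.
Context {m : nat} {N : manifold R m}.
Variable nb : forall p : N, 'rV[R]_m -> (N -> 'rV[R]_m) -> 'rV[R]_m.
Hypothesis nbP : connection nb.

Lemma nb0 P v : nb P v (fun=> 0) = 0.
Proof.
have := nb_add nbP v openT (I : setT P) (smooth_field0 _) (smooth_field0 _).
under eq_fun do rewrite addr0.
by move=> /eqP; rewrite -subr_eq subrr eq_sym => /eqP.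
Qed.

Lemma smooth_field_sum n (U : set N) (Y : 'I_n -> N -> 'rV[R]_m) : open U ->
  (forall i, smooth_field U (Y i)) -> smooth_field U (fun q => \sum_i Y i q).
Proof.
move=> oU; elim: n Y => [|n IH] Y sY.
  by under eq_fun do rewrite big_ord0; exact: smooth_field0.
under eq_fun do rewrite big_ord_recr/=.
by apply: smooth_fieldD => //; exact: IH.
Qed.

Lemma nb_sum n (U : set N) (Y : 'I_n -> N -> 'rV[R]_m) P v : open U -> U P ->
  (forall i, smooth_field U (Y i)) ->
  nb P v (fun q => \sum_i Y i q) = \sum_i nb P v (Y i).
Proof.
move=> oU UP; elim: n Y => [|n IH] Y sY.
  by under eq_fun do rewrite big_ord0; rewrite big_ord0 nb0.
under eq_fun do rewrite big_ord_recr/=.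
rewrite (nb_add nbP v oU UP)//; last exact: smooth_field_sum.
by rewrite big_ord_recr/= IH.
Qed.

Lemma nb_linear_sum (U : set N) (Y : N -> 'rV[R]_m) P w : open U -> U P ->
  smooth_field U Y -> nb P w Y = \sum_j w 0 j *: nb P (delta_mx 0 j) Y.
Proof.
move=> oU UP sY.
have Hl : linear (fun v => nb P v Y).
  by move=> a v u; rewrite (nb_linear nbP a v u oU UP sY).
pose nbL : {linear 'rV[R]_m -> 'rV[R]_m} := HB.pack (fun v => nb P v Y)
  (GRing.isLinear.Build _ _ _ _ _ Hl).
rewrite -[LHS]/(nbL w) {1}[w]row_sum_delta linear_sum.
by apply: eq_bigr => j _; rewrite linearZ.
Qed.

(** Locality of [nb] allows [Y] to be replaced by its frame expansion, valid only on the chart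
    domain; the Leibniz rule does the rest. The result has the shape of [pullback_conn], so ambient
    derivatives and pulled-back ones can be compared term by term. *)
Lemma nb_frame (U : set N) (Y : N -> 'rV[R]_m) P w : open U -> U P ->
  smooth_field U Y -> let c := chart_at P in
  nb P w Y = dfun (fun q => tcoord c q (Y q)) P w
    + \sum_k Y P 0 k *: nb P w (cframe c k).
Proof.
move=> oU UP sY c.
have ac : atlas c by exact: chart_atP.
have cP : cdom c P by exact: chart_at_dom.
have oV : open (U `&` cdom c) by apply: openI => //; exact: cdom_open.
have VP : (U `&` cdom c) P by [].
have sV : smooth_fun (U `&` cdom c) (fun q => tcoord c q (Y q)).
  exact: smooth_field_tcoord.
have sk k : smooth_fun (U `&` cdom c) (fun q => tcoord c q (Y q) 0 k).
  exact: smooth_fun_coord.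
have se k : smooth_field (U `&` cdom c) (cframe c k).
  by apply: smooth_field_sub (smooth_cframe k ac) => q [].
have sZ k : smooth_field (U `&` cdom c) (fun q => tcoord c q (Y q) 0 k *: cframe c k q).
  exact: smooth_fieldZ.
rewrite (nb_local nbP w oV VP (smooth_field_sub _ sY) (smooth_field_sum oV sZ));
  last first.
- by move=> q [_ cq]; exact: frame_expand.
- by move=> q [].
rewrite (nb_sum w oV VP sZ).
under eq_bigr do rewrite (nb_leibniz nbP w oV VP (sk _) (se _)) tcoord_chart_at.
rewrite big_split/=; congr (_ + _).
rewrite [RHS]row_sum_delta; apply: eq_bigr => k _.
rewrite cframe_chart_at; congr (_ *: _).
rewrite /dfun [RHS]derive_rowE//; apply: diff_derivable.
exact: (smooth_fun_row_differentiable oV sV).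
Qed.

End Connection.

Lemma differentiable_scale_row (V : normedModType R) n (g : V -> R)
    (F : V -> 'rV[R]_n) x :
  differentiable g x -> differentiable F x -> differentiable (fun y => g y *: F y) x.
Proof.
move=> dg dF; apply: row_differentiable => i; under eq_fun do rewrite mxE.
apply: differentiableM => //.
exact: (differentiable_comp dF (differentiable_coord _ 0 i)).
Qed.

Lemma derive_scale_row (V : normedModType R) n (g : V -> R) (F : V -> 'rV[R]_n) x v :
  differentiable g x -> differentiable F x ->
  'D_v (fun y => g y *: F y) x = 'D_v g x *: F x + g x *: 'D_v F x.
Proof.
move=> dg dF; have dgF := differentiable_scale_row dg dF.
have dFi i : differentiable (fun y => F y 0 i) x.
  exact: (differentiable_comp dF (differentiable_coord _ 0 i)).
apply/rowP => i; rewrite !mxE.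
rewrite (derive_rowE i (@diff_derivable _ _ _ _ x v dgF)).
rewrite (derive_rowE i (@diff_derivable _ _ _ _ x v dF)).
under eq_fun do rewrite mxE.
rewrite deriveM; [|exact: diff_derivable|exact: diff_derivable].
by rewrite addrC; congr (_ + _); exact: mulrC.
Qed.

Lemma derive_sum_scale_row (V : normedModType R) n k (g : 'I_k -> V -> R)
    (F : 'I_k -> V -> 'rV[R]_n) x v :
  (forall i, differentiable (g i) x) -> (forall i, differentiable (F i) x) ->
  'D_v (fun y => \sum_i g i y *: F i y) x =
    \sum_i 'D_v (g i) x *: F i x + \sum_i g i x *: 'D_v (F i) x.
Proof.
move=> dg dF.
have -> : (fun y => \sum_i g i y *: F i y) = \sum_i (fun y => g i y *: F i y).
  by apply/funext => y; rewrite fct_sumE.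
rewrite derive_sum; last first.
  by move=> i; apply/diff_derivable/differentiable_scale_row.
rewrite -big_split/=; apply: eq_bigr => i _; exact: derive_scale_row.
Qed.

Lemma differentiable_sum_scale_row (V : normedModType R) n k (g : 'I_k -> V -> R)
    (F : 'I_k -> V -> 'rV[R]_n) x :
  (forall i, differentiable (g i) x) -> (forall i, differentiable (F i) x) ->
  differentiable (fun y => \sum_i g i y *: F i y) x.
Proof.
move=> dg dF.
have -> : (fun y => \sum_i g i y *: F i y) = \sum_i (fun y => g i y *: F i y).
  by apply/funext => y; rewrite fct_sumE.
by apply: differentiable_sum => i; exact: differentiable_scale_row.
Qed.

(** * Fields along a smooth map *)

Section Along.
Context {m n : nat} {M : manifold R m} {N : manifold R n}.
Variable f : M -> N.
Hypothesis sf : smooth_map f.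

Lemma smooth_map_Cinfty (a : chart R M m) (c : chart R N n) : atlas a -> atlas c ->
  Cinfty (a @` (f @^-1` cdom c `&` cdom a)) (c \o f \o cinv a).
Proof. by move=> aa ac; have [_ /(_ c ac a aa)] := sf. Qed.

Lemma open_preimage_cdom (c : chart R N n) : open (f @^-1` cdom c).
Proof.
have [cf _] := sf.
by apply: open_comp; [move=> ? _; exact: cf|exact: cdom_open].
Qed.

Lemma open_map_img (a : chart R M m) (c : chart R N n) :
  open (a @` (f @^-1` cdom c `&` cdom a)).
Proof. by apply: chart_img_open; exact: open_preimage_cdom. Qed.

Lemma map_differentiable (a : chart R M m) (c : chart R N n) q :
  atlas a -> atlas c -> cdom a q -> cdom c (f q) ->
  differentiable (c \o f \o cinv a) (a q).
Proof.
move=> aa ac aq cq; apply: (C1_row_differentiable (@open_map_img a c)).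
  exact: smooth_map_Cinfty.
by exists q.
Qed.

Lemma near_map (a : chart R M m) (c : chart R N n) q : cdom a q -> cdom c (f q) ->
  \forall x \near a q, cdom c (f (cinv a x)) /\ cdom a (cinv a x).
Proof. by move=> aq cq; exact: (near_chart (open_preimage_cdom c)). Qed.

Lemma tmapE p v : tmap f p v =
  'd (chart_at (f p) \o f \o cinv (chart_at p)) (chart_at p p) v.
Proof. by rewrite /tmap lfunE. Qed.

Lemma tcoord_tmap (a : chart R M m) (c : chart R N n) q w :
  atlas a -> atlas c -> cdom a q -> cdom c (f q) ->
  tcoord c (f q) (tmap f q w) = 'd (c \o f \o cinv a) (a q) (tcoord a q w).
Proof.
move=> aa ac aq cq; rewrite tmapE /tcoord.
have ap := chart_atP q; have dp := chart_at_dom q.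
have ap' := chart_atP (f q); have dp' := chart_at_dom (f q).
transitivity ('d (c \o f \o cinv (chart_at q)) (chart_at q q) w).
  apply/esym/diff_near_comp => //=.
  - by rewrite cmapK.
  - exact: map_differentiable.
  - exact: transition_differentiable.
  - have := near_map dp dp'; apply: filterS => x [cx _] /=.
    by rewrite cmapK.
apply: diff_near_comp => //=.
- by rewrite cmapK.
- exact: transition_differentiable.
- exact: map_differentiable.
- have := near_chart (cdom_open a) aq dp; apply: filterS => x [cx _] /=.
  by rewrite cmapK.
Qed.

Lemma dfun_comp (F : N -> 'rV[R]_n) p v :
  differentiable (F \o cinv (chart_at (f p))) (chart_at (f p) (f p)) ->
  dfun (F \o f) p v = dfun F (f p) (tmap f p v) /\
  differentiable ((F \o f) \o cinv (chart_at p)) (chart_at p p).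
Proof.
move=> dF.
have ap := chart_atP p; have dp := chart_at_dom p.
have ap' := chart_atP (f p); have dp' := chart_at_dom (f p).
have df := map_differentiable ap ap' dp dp'.
set g := chart_at (f p) \o f \o cinv (chart_at p) in df.
have e : g (chart_at p p) = chart_at (f p) (f p) by rewrite /g /= cmapK.
have near_e : \forall x \near chart_at p p,
    ((F \o cinv (chart_at (f p))) \o g) x = ((F \o f) \o cinv (chart_at p)) x.
  by have := near_map dp dp'; apply: filterS => x [cx _] /=; rewrite /g /= cmapK.
have dc : differentiable ((F \o cinv (chart_at (f p))) \o g) (chart_at p p).
  by apply: differentiable_comp => //; rewrite e.
split; last exact: near_eq_differentiable dc.
rewrite /dfun -(near_eq_derive _ near_e) deriveE// diff_comp ?e// tmapE.
by rewrite deriveE.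
Qed.

(** Differentiability at a single point, rather than smoothness, because this is what can be
    recovered for fields obtained by inverting the tangent map pointwise. *)
Definition diff_along (V : M -> 'rV[R]_n) p : Prop :=
  differentiable ((fun q => tcoord (chart_at (f p)) (f q) (V q)) \o cinv (chart_at p))
    (chart_at p p).

Definition diff_field (X : M -> 'rV[R]_m) p : Prop :=
  differentiable ((fun q => tcoord (chart_at p) q (X q)) \o cinv (chart_at p))
    (chart_at p p).

Lemma smooth_diff_field X p : smooth_field setT X -> diff_field X p.
Proof.
move=> sX; have ap := chart_atP p; have dp := chart_at_dom p.
apply: (smooth_fun_row_differentiable _ (smooth_field_tcoord openT sX ap)) => //.
by apply: openI; [exact: openT|exact: cdom_open].
Qed.

(** * Push-forwards of vector fields and torsion *)

Section Push.
Variable p : M.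
Let a := chart_at p.
Let c := chart_at (f p).
Let F := c \o f \o cinv a.
Let x0 := a p.
Let aa : atlas a. Proof. exact: chart_atP. Qed.
Let ac : atlas c. Proof. exact: chart_atP. Qed.
Let ap : cdom a p. Proof. exact: chart_at_dom. Qed.
Let cp : cdom c (f p). Proof. exact: chart_at_dom. Qed.
Let oU := @open_map_img a c.
Let Ux0 : (a @` (f @^-1` cdom c `&` cdom a)) x0. Proof. by exists p. Qed.
Let CF : Cinfty (a @` (f @^-1` cdom c `&` cdom a)) F.
Proof. exact: smooth_map_Cinfty. Qed.

Lemma diff_partial u : differentiable (fun x => 'D_u F x) x0.
Proof. exact: (C1_row_differentiable oU (Ck_row_derive u oU (CF 2))). Qed.

(** In charts the tangent map is the Jacobian of [F]. The left-hand side separates the components of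
    [Y] from the partials of [F], which prepares the product rule. *)
Lemma push_coord (Y : M -> 'rV[R]_m) :
  \forall x \near x0, \sum_i (tcoord a (cinv a x) (Y (cinv a x))) 0 i
      *: 'D_(delta_mx 0 i) F x
    = tcoord c (f (cinv a x)) (tmap f (cinv a x) (Y (cinv a x))).
Proof.
have : \forall x \near x0, (a @` (f @^-1` cdom c `&` cdom a)) x.
  exact: open_nbhs_nbhs.
apply: filterS => _ [q [cq aq] <-]; rewrite cmapK//.
have dF := map_differentiable aa ac aq cq.
by rewrite (tcoord_tmap _ aa ac aq cq) -derive_row_sum// deriveE.
Qed.

Lemma push_coord_diff Y : diff_field Y p ->
  differentiable (fun x => \sum_i (tcoord a (cinv a x) (Y (cinv a x))) 0 i
      *: 'D_(delta_mx 0 i) F x) x0.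
Proof.
move=> dY; apply: differentiable_sum_scale_row => i; last exact: diff_partial.
exact: (differentiable_comp dY (differentiable_coord _ 0 i)).
Qed.

Lemma diff_along_push Y : diff_field Y p -> diff_along (fun q => tmap f q (Y q)) p.
Proof.
by move=> /push_coord_diff; apply: near_eq_differentiable; exact: push_coord.
Qed.

Lemma dfun_push Y v : diff_field Y p ->
  dfun (fun q => tcoord c (f q) (tmap f q (Y q))) p v =
  tmap f p (dfun (fun q => tcoord a q (Y q)) p v) + 'D_v ('D_(Y p) F) x0.
Proof.
move=> dY.
have dy i : differentiable (fun x => (tcoord a (cinv a x) (Y (cinv a x))) 0 i) x0.
  exact: (differentiable_comp dY (differentiable_coord _ 0 i)).
rewrite /dfun -(near_eq_derive v (push_coord Y)).
rewrite derive_sum_scale_row//; last by move=> i; exact: diff_partial.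
have dF := map_differentiable aa ac ap cp.
congr (_ + _).
  rewrite tmapE -deriveE// derive_row_sum//; apply: eq_bigr => i _.
  by rewrite derive_rowE//; exact: diff_derivable.
under eq_bigr do rewrite cmapK// tcoord_chart_at.
(* Swapping puts the direction [Y p] outermost, where it expands linearly into partial derivatives;
   each term is then swapped back. *)
rewrite (C2_derive_swap _ _ oU Ux0 (CF 2)) (derive_row_sum _ (diff_partial v)).
by apply: eq_bigr => i _; rewrite (C2_derive_swap _ _ oU Ux0 (CF 2)).
Qed.

(** Two symmetries cancel everything except the push-forward of the bracket: that of the second
    derivatives of the coordinate expression of [f], and that of the Christoffel symbols of [nb]. *)
Lemma push_torsion nb X Y : connection nb ->
  (forall U X Y p, open U -> U p -> smooth_field U X -> smooth_field U Y ->
      nb p (X p) Y - nb p (Y p) X = lie_bracket X Y p) ->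
  diff_field X p -> diff_field Y p ->
  pullback_conn f nb p (X p) (fun q => tmap f q (Y q))
  - pullback_conn f nb p (Y p) (fun q => tmap f q (X q)) = tmap f p (lie_bracket X Y p).
Proof.
move=> nbP nbT dX dY; rewrite /pullback_conn -/c.
have se k : smooth_field (cdom c) (cframe c k) by exact: smooth_cframe.
have oc := cdom_open c.
(* Coordinate fields have constant components in their own chart, so their bracket vanishes, and the
   absence of torsion makes the Christoffel symbols symmetric. *)
have sym j k : nb (f p) (delta_mx 0 j) (cframe c k) =
    nb (f p) (delta_mx 0 k) (cframe c j).
  have := nbT _ _ _ _ oc cp (se j) (se k); rewrite !cframe_chart_at.
  rewrite /lie_bracket -/c.
  have z i w : dfun (fun q => tcoord c q (cframe c i q)) (f p) w = 0 :> 'rV[R]_n.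
    rewrite /dfun -(@near_eq_derive _ _ _ (fun=> delta_mx 0 i)) ?derive_cst//.
    have := near_chart oc cp cp; apply: filterS => x [cx _] /=.
    by rewrite tcoord_cframe_id.
  by rewrite !z subrr => /eqP; rewrite subr_eq0 => /eqP.
rewrite !dfun_push//.
set A := tmap f p (X p); set B := tmap f p (Y p).
have E (u w : 'rV[R]_n) : \sum_k u 0 k *: nb (f p) w (cframe c k) =
    \sum_k \sum_j (u 0 k * w 0 j) *: nb (f p) (delta_mx 0 j) (cframe c k).
  apply: eq_bigr => k _; rewrite (nb_linear_sum nbP w oc cp (se k)) scaler_sumr.
  by apply: eq_bigr => j _; rewrite scalerA.
have -> : \sum_k A 0 k *: nb (f p) B (cframe c k) =
    \sum_k B 0 k *: nb (f p) A (cframe c k).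
  rewrite !E exchange_big/=; apply: eq_bigr => k _; apply: eq_bigr => j _.
  by rewrite mulrC sym.
rewrite (C2_derive_swap _ _ oU Ux0 (CF 2)).
rewrite /lie_bracket linearB/=.
have cancel (V : zmodType) (x y z t : V) : x + z + t - (y + z + t) = x - y.
  by rewrite opprD addrACA subrr addr0 opprD addrACA subrr addr0.
exact: cancel.
Qed.

End Push.
Lemma diff_along_coord p V k : diff_along V p -> differentiable
    ((fun q => tcoord (chart_at (f p)) (f q) (V q) 0 k) \o cinv (chart_at p))
    (chart_at p p).
Proof. by move=> dV; exact: (differentiable_comp dV (differentiable_coord _ 0 k)). Qed.

(** * Covariant derivative of an endomorphism field along a map *)

Section Endomorphism.
Variable phi : N -> 'End('rV[R]_n).
Hypothesis phi_smooth : forall U X, open U -> smooth_field U X ->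
  smooth_field U (fun p => phi p (X p)).
Variable p : M.
Let a := chart_at p.
Let c := chart_at (f p).
Let aa : atlas a. Proof. exact: chart_atP. Qed.
Let ac : atlas c. Proof. exact: chart_atP. Qed.
Let ap : cdom a p. Proof. exact: chart_at_dom. Qed.
Let cp : cdom c (f p). Proof. exact: chart_at_dom. Qed.
Let oc : open (cdom c). Proof. exact: cdom_open. Qed.
Let x0 := a p.
Let Phi k (r : N) := tcoord c r (phi r (cframe c k r)).
Let sphi k : smooth_field (cdom c) (fun r => phi r (cframe c k r)).
Proof. by apply: phi_smooth => //; exact: smooth_cframe. Qed.
Let dPhi k : differentiable (Phi k \o cinv c) (c (f p)).
Proof.
have oV : open (cdom c `&` cdom c) by exact: openI.
by apply: (smooth_fun_row_differentiable oV (smooth_field_tcoord oc (sphi k) ac)).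
Qed.

Let phi_coord (V : M -> 'rV[R]_n) :
  \forall x \near x0, \sum_k (tcoord c (f (cinv a x)) (V (cinv a x))) 0 k
      *: Phi k (f (cinv a x))
    = tcoord c (f (cinv a x)) (phi (f (cinv a x)) (V (cinv a x))).
Proof.
have := near_map ap cp; apply: filterS => x [cx _].
rewrite {2}(frame_expand (V (cinv a x)) ac cx) linear_sum tcoord_sum.
by apply: eq_bigr => k _; rewrite linearZ/= tcoordZ.
Qed.

Lemma diff_along_endo V : diff_along V p -> diff_along (fun q => phi (f q) (V q)) p.
Proof.
move=> dV; apply: near_eq_differentiable (phi_coord V) _.
apply: differentiable_sum_scale_row => k; first exact: diff_along_coord.
by have [] := dfun_comp 0 (dPhi k).
Qed.

(** Product rule for the components of [V] times the rows [Phi k] of the matrix of [phi] in the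
    coordinate frame. *)
Lemma dfun_endo V v : diff_along V p ->
  dfun (fun q => tcoord c (f q) (phi (f q) (V q))) p v =
  phi (f p) (dfun (fun q => tcoord c (f q) (V q)) p v)
  + \sum_k V p 0 k *: dfun (Phi k) (f p) (tmap f p v).
Proof.
move=> dV.
have e1 : \sum_k 'D_v (fun y => tcoord c (f (cinv a y)) (V (cinv a y)) 0 k) x0
    *: Phi k (f (cinv a x0)) = phi (f p) (dfun (fun q => tcoord c (f q) (V q)) p v).
  rewrite [in RHS](row_sum_delta (dfun _ _ _)) linear_sum.
  apply: eq_bigr => k _; rewrite linearZ/= cmapK// /Phi tcoord_chart_at cframe_chart_at.
  by congr (_ *: _); rewrite /dfun derive_rowE//; exact: diff_derivable.
have e2 : \sum_k (tcoord c (f (cinv a x0)) (V (cinv a x0))) 0 k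
    *: 'D_v (fun y => Phi k (f (cinv a y))) x0 =
    \sum_k V p 0 k *: dfun (Phi k) (f p) (tmap f p v).
  have e0 : tcoord c (f (cinv a x0)) (V (cinv a x0)) = V p.
    by rewrite cmapK// tcoord_chart_at.
  apply: eq_bigr => k _; rewrite e0.
  by rewrite -(dfun_comp v (dPhi k)).1.
rewrite -e1 -e2 {1}/dfun -(near_eq_derive v (phi_coord V)).
apply: derive_sum_scale_row; first by move=> i; exact: diff_along_coord.
by move=> k; have [] := dfun_comp 0 (dPhi k).
Qed.

(* [(nb_X phi) V], computed along [f], is tensorial in [V]. *)
Lemma pullback_conn_endo nb v V : connection nb -> diff_along V p ->
  pullback_conn f nb p v (fun q => phi (f q) (V q))
  - phi (f p) (pullback_conn f nb p v V) =
  \sum_j \sum_k (tmap f p v 0 j * V p 0 k) *: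
    (nb (f p) (delta_mx 0 j) (fun r => phi r (cframe c k r))
     - phi (f p) (nb (f p) (delta_mx 0 j) (cframe c k))).
Proof.
move=> nbP dV; rewrite /pullback_conn -/c.
have se k : smooth_field (cdom c) (cframe c k) by exact: smooth_cframe.
set w := tmap f p v.
have -> : \sum_j \sum_k (w 0 j * V p 0 k) *:
    (nb (f p) (delta_mx 0 j) (fun r => phi r (cframe c k r))
     - phi (f p) (nb (f p) (delta_mx 0 j) (cframe c k))) =
  \sum_k V p 0 k *: (nb (f p) w (fun r => phi r (cframe c k r))
     - phi (f p) (nb (f p) w (cframe c k))).
  rewrite exchange_big/=; apply: eq_bigr => k _.
  rewrite (nb_linear_sum nbP w oc cp (se k)) (nb_linear_sum nbP w oc cp (sphi k)).
  rewrite linear_sum -sumrB scaler_sumr; apply: eq_bigr => j _.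
  by rewrite linearZ/= -scalerBr scalerA mulrC.
rewrite dfun_endo// -/w.
have -> : \sum_l phi (f p) (V p) 0 l *: nb (f p) w (cframe c l) =
    \sum_k V p 0 k *: \sum_l phi (f p) (delta_mx 0 k) 0 l *: nb (f p) w (cframe c l).
  under [RHS]eq_bigr do rewrite scaler_sumr.
  rewrite exchange_big/=; apply: eq_bigr => l _.
  rewrite [in LHS](row_sum_delta (V p)) linear_sum summxE scaler_suml.
  by apply: eq_bigr => k _; rewrite linearZ/= mxE scalerA.
(* Expanding the derivative of the ambient field [phi e_k] by [nb_frame] produces the same
   derivatives of [Phi k] as [dfun_endo] does; only the term with derivatives of [V] remains, and it
   occurs on the left with both signs. *)
have -> : \sum_k V p 0 k *: (nb (f p) w (fun r => phi r (cframe c k r))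
     - phi (f p) (nb (f p) w (cframe c k))) =
  \sum_k V p 0 k *: dfun (Phi k) (f p) w +
  \sum_k V p 0 k *: (\sum_l phi (f p) (delta_mx 0 k) 0 l *: nb (f p) w (cframe c l))
  - phi (f p) (\sum_k V p 0 k *: nb (f p) w (cframe c k)).
  rewrite linear_sum -big_split/= -sumrB; apply: eq_bigr => k _.
  rewrite linearZ/= -scalerDr -scalerBr; congr (_ *: (_ - _)).
  by rewrite (nb_frame nbP w oc cp (sphi k)) -/c cframe_chart_at.
rewrite linearD.
have cancel (U : zmodType) (x y z t : U) : x + y + z - (x + t) = y + z - t.
  by rewrite opprD addrA; congr (_ - t); rewrite -[x + y + z]addrA addrC addKr.
exact: cancel.
Qed.

End Endomorphism.

(** * Determinants and differentiable solutions of linear systems *)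

Lemma differentiable_bigsum (V : normedModType R) (I : Type) (r : seq I) (P : pred I)
    (F : I -> V -> R) x : (forall i, differentiable (F i) x) ->
  differentiable (fun y => \sum_(i <- r | P i) F i y) x.
Proof.
move=> dF; elim: r => [|i r IH].
  by under eq_fun do rewrite big_nil; exact: differentiable_cst.
under eq_fun do rewrite big_cons; case: (P i) => //; exact: differentiableD.
Qed.

Lemma differentiable_bigprod (V : normedModType R) (I : Type) (r : seq I) (P : pred I)
    (F : I -> V -> R) x : (forall i, differentiable (F i) x) ->
  differentiable (fun y => \prod_(i <- r | P i) F i y) x.
Proof.
move=> dF; elim: r => [|i r IH].
  by under eq_fun do rewrite big_nil; exact: differentiable_cst.
under eq_fun do rewrite big_cons; case: (P i) => //; exact: differentiableM.
Qed.

Lemma differentiable_det (V : normedModType R) k (A : V -> 'M[R]_k) x :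
  (forall i j, differentiable (fun y => A y i j) x) ->
  differentiable (fun y => \det (A y)) x.
Proof.
move=> dA; apply: differentiable_bigsum => s; apply: differentiableM => //.
exact: differentiable_bigprod.
Qed.

(** With [K] a right inverse of [J x], the square matrix [J y *m K] is the identity at [x], hence
    has nonzero determinant nearby. There [z] is expressed through its adjugate and determinant,
    which are polynomial in differentiable entries. *)
Lemma differentiable_linear_solve (V : normedModType R) k l (z : V -> 'rV[R]_k)
    (J : V -> 'M[R]_(k, l)) (u : V -> 'rV[R]_l) x :
  (\forall y \near x, z y *m J y = u y) -> row_free (J x) ->
  (forall i j, differentiable (fun y => J y i j) x) -> differentiable u x ->
  differentiable z x.
Proof.
move=> zJ /row_freeP[K JK] dJ du.
pose A y := J y *m K.
have dA i j : differentiable (fun y => A y i j) x.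
  under eq_fun do rewrite mxE; apply: differentiable_bigsum => s.
  exact: differentiableM.
have dui i : differentiable (fun y => u y 0 i) x.
  exact: (differentiable_comp du (differentiable_coord _ 0 i)).
have duK i : differentiable (fun y => (u y *m K) 0 i) x.
  under eq_fun do rewrite mxE; apply: differentiable_bigsum => s.
  exact: differentiableM.
have dadj i j : differentiable (fun y => (\adj (A y)) i j) x.
  under eq_fun do rewrite mxE; apply: differentiableM => //.
  by apply: differentiable_det => s t; under eq_fun do rewrite 2!mxE.
have ddet := differentiable_det dA.
have det1 : \det (A x) = 1 by rewrite /A JK det1.
have ndet : \forall y \near x, \det (A y) != 0.
  have := differentiable_continuous ddet => /cvgrPdist_lt/(_ 1 ltr01).
  apply: filterS => y; rewrite det1; apply: contraTneq => ->.
  by rewrite subr0 normr1 ltxx.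
apply: (@near_eq_differentiable _ _
  (fun y => (\det (A y))^-1 *: (u y *m K *m \adj (A y)))).
  near=> y; have d0 : \det (A y) != 0 by near: y.
  have <- : z y *m J y = u y by near: y.
  rewrite -[_ *m K]mulmxA -/(A y) -mulmxA mul_mx_adj mul_mx_scalar scalerA.
  by rewrite mulVf// scale1r.
apply: differentiable_scale_row.
  by apply: differentiableV => //; rewrite det1 oner_neq0.
apply: row_differentiable => i; under eq_fun do rewrite mxE.
by apply: differentiable_bigsum => s; exact: differentiableM.
Unshelve. all: by end_near. Qed.

(* [Z] is recovered from its push-forward by Cramer's rule. *)
Lemma diff_field_of_push Z p : lker (tmap f p) = 0%VS ->
  diff_along (fun q => tmap f q (Z q)) p -> diff_field Z p.
Proof.
move=> inj dV.
pose F := chart_at (f p) \o f \o cinv (chart_at p).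
pose J x : 'M[R]_(m, n) := \matrix_(i, j) ('D_(delta_mx 0 i) F x) 0 j.
apply: (differentiable_linear_solve (J := J)) dV.
- apply: filterS (push_coord p Z) => x /= <-.
  apply/rowP => j; rewrite mxE summxE; apply: eq_bigr => i _.
  by rewrite !mxE.
(* The rows of [J] at the point are the images of the basis vectors under the tangent map, so a left
   inverse of that map is a right inverse of [J] in the row-vector convention. *)
- apply/row_freeP; exists (lin1_mx (tmap f p)^-1%VF).
  apply/row_matrixP => i; rewrite row_mul.
  have -> : row i (J (chart_at p p)) = tmap f p (delta_mx 0 i).
    apply/rowP => j; rewrite !mxE tmapE deriveE//.
    by apply: map_differentiable; first [exact: chart_atP|exact: chart_at_dom].
  by rewrite mul_rV_lin1/= row1 lker0_lfunK//; apply/eqP.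
- move=> i j; under eq_fun do rewrite mxE.
  exact: (differentiable_comp (diff_partial p (delta_mx 0 i))
    (differentiable_coord _ 0 j)).
Qed.

End Along.

End Charts.

(** * Linear algebra of degenerate forms *)

Section Forms.
Context {R : realType} {n : nat}.
Variable G : 'M[R]_n.
Local Notation g := (gform G).

Lemma gformDl u v w : g (u + v) w = g u w + g v w.
Proof. by rewrite /gform !mulmxDl mxE. Qed.

Lemma gformDr u v w : g w (u + v) = g w u + g w v.
Proof. by rewrite /gform linearD mulmxDr mxE. Qed.

Lemma gformZl a u w : g (a *: u) w = a * g u w.
Proof. by rewrite /gform -!scalemxAl mxE. Qed.

Lemma gformZr a u w : g w (a *: u) = a * g w u.
Proof. by rewrite /gform linearZ/= -scalemxAr mxE. Qed.

Lemma gformBr u v w : g w (u - v) = g w u - g w v.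
Proof. by rewrite gformDr -scaleN1r gformZr mulN1r. Qed.

Lemma gform0l u : g 0 u = 0.
Proof. by rewrite -(scale0r (0 : 'rV_n)) gformZl mul0r. Qed.

Lemma gform_suml k (u : 'I_k -> 'rV[R]_n) w : g (\sum_i u i) w = \sum_i g (u i) w.
Proof. by rewrite /gform !mulmx_suml summxE. Qed.

Lemma gform_sumr k (u : 'I_k -> 'rV[R]_n) w : g w (\sum_i u i) = \sum_i g w (u i).
Proof. by rewrite /gform linear_sum mulmx_sumr summxE. Qed.

Lemma gformC u v : G^T = G -> g u v = g v u.
Proof.
move=> sG; rewrite /gform; transitivity ((u *m G *m v^T)^T 0 0).
  by rewrite [RHS]mxE.
by rewrite !trmx_mul trmxK sG mulmxA.
Qed.

Lemma orthP (U : {vspace 'rV[R]_n}) v :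
  reflect (forall u, u \in U -> g u v = 0) (v \in orth G U).
Proof.
have lin u : linear (fun v => (g u v : R^o)).
  by move=> a x y; rewrite gformDr gformZr.
pose L u : {linear 'rV[R]_n -> R^o} := HB.pack (fun v => (g u v : R^o))
  (GRing.isLinear.Build _ _ _ _ _ (lin u)).
have kerE u : (v \in lker (linfun (fun v => (g u v : R^o)))) = (g u v == 0).
  by rewrite memv_ker (_ : (fun v => _) = L u)// lfunE.
have E : (v \in orth G U) = all (fun u => g u v == 0) (vbasis U).
  rewrite /orth; elim: (vbasis U : seq _) => [|u s IH]; first by rewrite big_nil memvf.
  by rewrite big_cons memv_cap IH kerE.
rewrite E; apply: (iffP allP) => [H u uU|H u /vbasis_mem /H /eqP//].
rewrite (coord_vbasis uU) gform_suml big1// => i _.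
by rewrite gformZl (eqP (H _ (mem_nth _ _))) ?mulr0// size_tuple.
Qed.

(** [orth G U] is the kernel of the map pairing a vector with a basis of [U], so its codimension is
    at most the dimension of [U]; as it meets [U] trivially, the dimensions add up to that of the
    whole space. *)
Lemma nondegenerate_sum U : Defs.nondegenerate G U -> (U + orth G U = fullv)%VS.
Proof.
move=> nd; pose F v : 'rV[R]_(\dim U) := \row_i g ((vbasis U)`_i) v.
have linF : linear F.
  by move=> a x y; apply/rowP => i; rewrite !mxE gformDr gformZr.
pose FL : {linear 'rV[R]_n -> 'rV[R]_(\dim U)} := HB.pack F
  (GRing.isLinear.Build _ _ _ _ _ linF).
have kerF : lker (linfun FL) = orth G U.
  apply/vspaceP => v; rewrite memv_ker lfunE/=; apply/eqP/orthP => [Fv u uU|H].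
    rewrite (coord_vbasis uU) gform_suml big1// => i _.
    have /rowP/(_ i) := Fv; rewrite !mxE => e.
    by rewrite gformZl e mulr0.
  apply/rowP => i; rewrite !mxE; apply: H; apply: vbasis_mem.
  by rewrite mem_nth// size_tuple.
apply/eqP; rewrite eqEdim subvf/=.
rewrite (dimv_disjoint_sum nd).
have := limg_ker_dim (linfun FL) fullv; rewrite capfv kerF => <-.
rewrite addnC leq_add2r (leq_trans (dimvS (subvf _)))// dimvf/=.
by rewrite /dim/= mul1n.
Qed.

Lemma nondegenerate_decomp U v : Defs.nondegenerate G U ->
  exists2 u, u \in U & forall w, w \in U -> g w (v - u) = 0.
Proof.
move=> nd; have : v \in (U + orth G U)%VS by rewrite nondegenerate_sum// memvf.
move=> /memv_addP[u uU [w wU ->]]; exists u => // z zU.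
by rewrite addrC addKr; move/orthP: wU; apply.
Qed.

Lemma nondegenerate_eq0 U v : Defs.nondegenerate G U -> v \in U ->
  (forall w, w \in U -> g w v = 0) -> v = 0.
Proof.
move=> nd vU H; apply/eqP; rewrite -memv0 -nd memv_cap vU/=.
exact/orthP.
Qed.

(* [T], [S], [S'], [K] stand for TM, S(TM), S(TM^perp) and ltr(TM) at a point. *)
Lemma lightlike_direct (r : nat) (E B : 'I_r -> 'rV[R]_n)
    (T S S' K : {vspace 'rV[R]_n}) : G^T = G ->
  let Rad := (T :&: orth G T)%VS in
  Rad = (\sum_a <[E a]>)%VS -> K = (\sum_a <[B a]>)%VS ->
  (forall a b, g (E a) (B b) = (a == b)%:R) ->
  (Rad + S = T)%VS -> Defs.nondegenerate G S ->
  (Rad + S' = orth G T)%VS -> (Rad :&: S' = 0)%VS -> Defs.nondegenerate G S' ->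
  (T :&: (K + S') = 0)%VS /\ (T + (K + S') = fullv)%VS.
Proof.
move=> sG Rad RadE KE EB RS ndS RS' capS' ndS'.
have ER a : E a \in Rad by rewrite RadE memvE (sumv_sup a).
have RT : (Rad <= T)%VS by exact: capvSl.
have RT' : (Rad <= orth G T)%VS by exact: capvSr.
have ST : (S <= T)%VS by rewrite -RS addvSr.
have ST' : (S' <= orth G T)%VS by rewrite -RS' addvSr.
have TT' x y : x \in T -> y \in orth G T -> g x y = 0 by move=> xT /orthP; apply.
have T'T x y : x \in T -> y \in orth G T -> g y x = 0.
  by move=> xT yT; rewrite gformC// TT'.
have ET a : E a \in T by exact: (subvP RT).
have ET' a : E a \in orth G T by exact: (subvP RT').
have BK a : B a \in K by rewrite KE memvE (sumv_sup a).
split.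
  apply/eqP; rewrite -subv0; apply/subvP => x; rewrite memv_cap => /andP[xT].
  move=> /memv_addP[l lK [s sS' xE]]; rewrite KE in lK.
  have [la laB lE] := memv_sumP lK.
  have [c cE] : exists c : 'I_r -> R, l = \sum_a c a *: B a.
    have ex a : exists k, la a = k *: B a by apply/vlineP; exact: laB.
    by exists (fun a => sval (cid (ex a))); rewrite lE;
      apply: eq_bigr => a _; case: cid.
  (* [E a] lies in [T] and in its orthogonal, so pairing with it kills [s] and [x] alike and
     isolates the coefficient [c a]. Then [x = s] lies in both [Rad] and [S']. *)
  have c0 a : c a = 0.
    have := T'T _ _ xT (ET' a); rewrite xE gformDr.
    rewrite (TT' _ _ (ET a) (subvP ST' _ sS')) addr0.
    rewrite cE gform_sumr (bigD1 a)//= big1 ?addr0 => [|b ba].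
      by rewrite gformZr EB eqxx mulr1.
    by rewrite gformZr EB eq_sym (negbTE ba) mulr0.
  have xs : x = s by rewrite xE cE big1 ?add0r// => a _; rewrite c0 scale0r.
  rewrite -capS' memv_cap; apply/andP; split; last by rewrite xs.
  by rewrite memv_cap xT xs; exact: (subvP ST').
apply/eqP; rewrite eqEsubv subvf; apply/subvP => v _.
(* Remove from [v] a combination of the [B a] to make it orthogonal to [Rad], then its components in
   [S] and [S']. The remainder [v3] is orthogonal to [T], hence in [Rad + S'], and being orthogonal
   to [S'] too it lies in [Rad]. *)
pose v1 := v - \sum_a g (E a) v *: B a.
have Ev1 a : g (E a) v1 = 0.
  rewrite /v1 gformBr gform_sumr (bigD1 a)//= big1 => [|b ba].
    by rewrite gformZr EB eqxx mulr1 addr0 subrr.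
  by rewrite gformZr EB eq_sym (negbTE ba) mulr0.
have [s sS Hs] := nondegenerate_decomp v1 ndS.
have [s' s'S' Hs'] := nondegenerate_decomp (v1 - s) ndS'.
pose v3 := v1 - s - s'.
have v3T' : v3 \in orth G T.
  apply/orthP => u; rewrite -RS => /memv_addP[r' r'R [u' u'S ->]].
  have u'v : g u' v3 = 0.
    rewrite /v3 gformBr Hs// TT' ?subr0//.
      exact: (subvP ST).
    exact: (subvP ST').
  have Ev3 a : g (E a) v3 = 0.
    rewrite /v3 gformBr gformBr Ev1.
    rewrite (T'T _ _ (subvP ST _ sS) (ET' a)).
    by rewrite (TT' _ _ (ET a) (subvP ST' _ s'S')) !subr0.
  rewrite gformDl u'v addr0; move: r'R; rewrite RadE => /memv_sumP[ra raE ->].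
  rewrite gform_suml big1// => a _.
  by have /vlineP[k ->] := raE a isT; rewrite gformZl Ev3 mulr0.
move: (v3T'); rewrite -RS' => /memv_addP[r' r'R [t t'S v3E]].
have t0 : t = 0.
  apply: (nondegenerate_eq0 ndS') => // w wS'.
  have -> : t = v3 - r' by rewrite v3E addrC addKr.
  rewrite gformBr (Hs' _ wS') T'T ?subr0//.
    exact: (subvP RT).
  exact: (subvP ST').
have -> : v = (s + r') + (\sum_a g (E a) v *: B a + s').
  have v3r : v1 - s - s' = r' by rewrite -/v3 v3E t0 addr0.
  have v1E : v1 = s + r' + s' by rewrite -v3r -addrA subrK addrC subrK.
  rewrite [\sum_a _ + s']addrC addrA -v1E.
  by rewrite subrK.
apply: memv_add; first by apply: memvD; [exact: (subvP ST)|exact: (subvP RT)].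
by apply: memv_add => //; apply: memv_suml => a _; exact: memvZ.
Qed.

End Forms.

Lemma daddv_pi_eq0 (K : fieldType) (V : vectType K) (U W : {vspace V}) v :
  (U :&: W = 0)%VS -> v \in W -> daddv_pi U W v = 0.
Proof.
move=> d vW; have vUW : v \in (U + W)%VS by exact: (subvP (addvSr _ _)).
have := daddv_pi_add d vUW.
have -> : daddv_pi W U v = v by apply: daddv_pi_id => //; rewrite capvC.
by move/eqP; rewrite -subr_eq0 addrK => /eqP.
Qed.

(** * QGCR-lightlike submanifolds *)

Section NearlySasakianAlong.
Context {R : realType} {n m : nat} {Mbar : manifold R n.*2.+1}.
Variables (NS : nearlySasakian Mbar) (M : manifold R m) (iota : M -> Mbar).
Hypothesis Hsub : submanifold iota.

Local Notation TN := 'rV[R]_(n.*2.+1).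
Local Notation phi p := (ns_phi NS (iota p)).
Local Notation g p := (gform (ns_g NS (iota p))).
Local Notation eta p := (ns_eta NS (iota p)).
Local Notation xi p := (ns_xi NS (iota p)).

Lemma ns_connection : connection (@ns_nabla _ _ _ NS).
Proof. exact: lc_conn (ns_lc NS). Qed.

(** The compatibility of the metric with phi, taken at xi, where phi xi = 0. *)
Lemma ns_eta_g P v : ns_eta NS P v = gform (ns_g NS P) (ns_xi NS P) v.
Proof.
have := ns_g_phi NS P (ns_xi NS P) v.
rewrite ns_phi_xi gform0l ns_eta_xi mul1r => /eqP.
by rewrite eq_sym subr_eq0 => /eqP ->.
Qed.

(** By [pullback_conn_endo] the left-hand side is bilinear in the values of the two fields at [p],
    as is the right-hand side. So [ns_nearly] for the ambient coordinate fields, which is [H] below,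
    gives the general case by expansion. *)
Lemma nearly_along X Y p : diff_field X p -> diff_field Y p ->
  let phiX q := phi q (push iota X q) in let phiY q := phi q (push iota Y q) in
  nabla_bar NS iota X phiY p - phi p (nabla_bar NS iota X (push iota Y) p)
  + (nabla_bar NS iota Y phiX p - phi p (nabla_bar NS iota Y (push iota X) p))
  = (2 * g p (push iota X p) (push iota Y p)) *: xi p
    - eta p (push iota Y p) *: push iota X p
    - eta p (push iota X p) *: push iota Y p.
Proof.
move=> dX dY phiX phiY; have sm := sub_smooth Hsub.
have aX : diff_along iota (push iota X) p by exact: diff_along_push.
have aY : diff_along iota (push iota Y) p by exact: diff_along_push.
have EX := pullback_conn_endo sm (@ns_phi_smooth _ _ _ NS) (X p) ns_connection aY.
have EY := pullback_conn_endo sm (@ns_phi_smooth _ _ _ NS) (Y p) ns_connection aX.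
apply: etrans (f_equal2 +%R EX EY) _.
set c := chart_at (iota p).
have ac : atlas c by exact: chart_atP.
have cp : cdom c (iota p) by exact: chart_at_dom.
set D := fun j k : 'I_(n.*2.+1) => ns_nabla NS (iota p) (delta_mx 0 j)
  (fun r => ns_phi NS r (cframe c k r))
  - phi p (ns_nabla NS (iota p) (delta_mx 0 j) (cframe c k)).
have H j k : D j k + D k j = (2 * g p (delta_mx 0 j) (delta_mx 0 k)) *: xi p
    - eta p (delta_mx 0 k) *: delta_mx 0 j - eta p (delta_mx 0 j) *: delta_mx 0 k.
  have := ns_nearly NS (cdom_open c) cp (smooth_cframe j ac) (smooth_cframe k ac).
  by rewrite /= !cframe_chart_at.
rewrite -/(push iota X p) -/(push iota Y p).
set x := push iota X p; set y := push iota Y p.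
(* Renaming the indices gives both double sums the same coefficients, so that [D j k] and [D k j]
   pair up as in [H]. *)
have -> : \sum_j \sum_k (y 0 j * x 0 k) *: D j k =
    \sum_j \sum_k (x 0 j * y 0 k) *: D k j.
  rewrite exchange_big/=; apply: eq_bigr => j _; apply: eq_bigr => k _.
  by rewrite mulrC.
rewrite -big_split/=.
under eq_bigr do rewrite -big_split/=.
under eq_bigr do under eq_bigr do rewrite -scalerDr H.
transitivity (\sum_j \sum_k (
    (2 * g p (x 0 j *: delta_mx 0 j) (y 0 k *: delta_mx 0 k)) *: xi p
    - eta p (y 0 k *: delta_mx 0 k) *: (x 0 j *: delta_mx 0 j)
    - eta p (x 0 j *: delta_mx 0 j) *: (y 0 k *: delta_mx 0 k))).
  apply: eq_bigr => j _; apply: eq_bigr => k _.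
  have etaZ a v : eta p (a *: v) = a * eta p v by rewrite linearZ.
  rewrite 2!scalerBr gformZl gformZr !etaZ !scalerA.
  by congr (_ *: _ - _ *: _ - _ *: _); ring.
have etaE u : eta p u = \sum_k eta p (u 0 k *: delta_mx 0 k).
  by rewrite {1}(row_sum_delta u) linear_sum.
have -> : (2 * g p x y) *: xi p = \sum_j \sum_k
    (2 * g p (x 0 j *: delta_mx 0 j) (y 0 k *: delta_mx 0 k)) *: xi p.
  rewrite {1}(row_sum_delta x) {1}(row_sum_delta y) gform_suml mulr_sumr scaler_suml.
  by apply: eq_bigr => j _; rewrite gform_sumr mulr_sumr scaler_suml.
have -> : eta p y *: x = \sum_j \sum_k
    eta p (y 0 k *: delta_mx 0 k) *: (x 0 j *: delta_mx 0 j).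
  rewrite etaE {1}(row_sum_delta x) scaler_sumr.
  by apply: eq_bigr => j _; rewrite scaler_suml.
have -> : eta p x *: y = \sum_j \sum_k
    eta p (x 0 j *: delta_mx 0 j) *: (y 0 k *: delta_mx 0 k).
  rewrite etaE {1}(row_sum_delta y) scaler_suml.
  by apply: eq_bigr => j _; rewrite scaler_sumr.
by rewrite -!sumrB; apply: eq_bigr => j _; rewrite -!sumrB.
Qed.

Lemma nabla_bar_torsion X Y p : diff_field X p -> diff_field Y p ->
  nabla_bar NS iota X (push iota Y) p - nabla_bar NS iota Y (push iota X) p
  = push iota (lie_bracket X Y) p.
Proof.
move=> dX dY; apply: (push_torsion (sub_smooth Hsub)) => //.
  exact: ns_connection.
by move=> U Z W q; exact: (lc_torsion (ns_lc NS)).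
Qed.

Lemma push_pull V p : V p \in TM iota p -> push iota (pull iota V) p = V p.
Proof. by move=> VT; rewrite /push /pull limg_lfunVK. Qed.

Lemma pull_eq0 V p : V p \in TM iota p -> pull iota V p = 0 -> V p = 0.
Proof. by move=> VT V0; rewrite -(push_pull VT) /push V0 linear0. Qed.

Lemma push_TM X p : push iota X p \in TM iota p.
Proof. by rewrite /push /TM memv_img// memvf. Qed.

(** * The splittings of the tangent spaces and the transversal identity *)

Section QGCRTheory.
Variables (L : lightlike (ns_g NS) iota) (Q : QGCR L).

(** Makes [tan_part] and [tr_part] complementary projections, since [daddv_pi] decomposes a vector
    only along a direct sum. *)
Lemma TM_tr p : (TM iota p :&: trTM L p = 0)%VS /\ (TM iota p + trTM L p = fullv)%VS.
Proof.
have [U [E [B [_ Up _ /(_ p Up)[RadE KE _ EB _]]]]] := ll_ltrP L p.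
apply: (lightlike_direct (sr_sym (ns_riem NS) (iota p)) RadE KE EB).
- exact: ll_STM_sum.
- exact: ll_STM_nondeg.
- exact: ll_STMperp_sum.
- exact: ll_STMperp_cap.
- exact: ll_STMperp_nondeg.
Qed.

Lemma tan_tr p v : tan_part L p v + tr_part L p v = v.
Proof. by have [d f] := TM_tr p; apply: daddv_pi_add; rewrite // f memvf. Qed.

Lemma tr_partT p v : v \in TM iota p -> tr_part L p v = 0.
Proof. by have [d _] := TM_tr p; apply: daddv_pi_eq0; rewrite capvC. Qed.

Lemma tan_part_TM p v : tan_part L p v \in TM iota p.
Proof. exact: memv_pi. Qed.

Lemma tr_partD p u v : tr_part L p (u + v) = tr_part L p u + tr_part L p v.
Proof. exact: linearD. Qed.

Lemma tr_partB p u v : tr_part L p (u - v) = tr_part L p u - tr_part L p v.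
Proof. exact: linearB. Qed.

Lemma tr_partZ p a v : tr_part L p (a *: v) = a *: tr_part L p v.
Proof. exact: linearZ. Qed.

(** The summands of Dhat may overlap, so a common vector is first compared in Rad TM and in S(TM)
    separately. The radical components then lie in both D1 and D2, and the screen components in D0
    and in its orthogonal complement within S(TM). *)
Lemma distD_cap p : (distD Q p :&: distDhat Q p = 0)%VS.
Proof.
apply/eqP; rewrite -subv0; apply/subvP => x; rewrite memv_cap => /andP[].
move=> /memv_addP[d0 d0D [d1 d1D xE]]; rewrite /distDhat -addvA.
move=> /memv_addP[d2 d2D [e eE xE']].
have eS : e \in ll_STM L p by rewrite (qSTM_sum Q) (subvP (addvSl _ _)).
have d0S : d0 \in ll_STM L p by rewrite (qSTM_sum Q) (subvP (addvSr _ _)).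
have d1R : d1 \in RadTM (ns_g NS) iota p by rewrite (qRad_sum Q) (subvP (addvSl _ _)).
have d2R : d2 \in RadTM (ns_g NS) iota p by rewrite (qRad_sum Q) (subvP (addvSr _ _)).
have E : d1 - d2 = e - d0.
  by apply/eqP; rewrite subr_eq addrAC eq_sym subr_eq addrC -xE' xE addrC.
have z : d1 - d2 = 0.
  apply/eqP; rewrite -memv0 -(ll_STM_cap L p) memv_cap memvB//= E memvB//.
have d12 : d1 = d2 by apply/eqP; rewrite -subr_eq0 z.
have ed0 : e = d0 by apply/eqP; rewrite -subr_eq0 -E z.
have d10 : d1 = 0 by apply/eqP; rewrite -memv0 -(qRad_cap Q p) memv_cap d1D d12.
have d00 : d0 = 0 by apply/eqP; rewrite -memv0 -(qSTM_cap Q p) memv_cap d0D -ed0 eE.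
by rewrite memv0 xE d10 d00 addr0.
Qed.

Lemma distD_sum p : (distD Q p + distDhat Q p = TM iota p)%VS.
Proof.
rewrite -(ll_STM_sum L p) (qSTM_sum Q) (qRad_sum Q) /distD /distDhat.
rewrite -[(qD2 Q p + _ + _)%VS]addvA; set E := (_ @: _ + _)%VS.
by rewrite -addvA addvC -!addvA.
Qed.

Lemma distD_TM p : (distD Q p <= TM iota p)%VS.
Proof. by rewrite -distD_sum addvSl. Qed.

Lemma phi_distD p v : v \in distD Q p -> phi p v \in distD Q p.
Proof.
move=> /memv_addP[d0 d0D [d1 d1D ->]]; rewrite linearD; apply: memv_add.
  by apply: (subvP (q_phiD0 Q p)); exact: memv_img.
by have := memv_img (phi p) d1D; rewrite q_phiD1.
Qed.

Lemma tr_phi_distD p v : v \in distD Q p -> tr_part L p (phi p v) = 0.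
Proof. by move=> vD; apply/tr_partT/(subvP (distD_TM p))/phi_distD. Qed.

(* If [a xi] lies in Dhat with [a != 0], then [xi] is tangent and, modulo the
   range of phi, belongs to D2, which is orthogonal to TM: so eta xi = 0. *)
Lemma phi_distDhat_eq0 p v : v \in distDhat Q p -> phi p v = 0 -> v = 0.
Proof.
move=> vD v0; have := ns_phi2 NS (iota p) v; rewrite v0 linear0 => /esym/eqP.
rewrite addrC subr_eq0 eq_sym => /eqP vE.
have vT : v \in TM iota p by rewrite -distD_sum (subvP (addvSr _ _)).
suff eta0 : eta p v = 0 by rewrite vE eta0 scale0r.
move: (vD); rewrite /distDhat -addvA => /memv_addP[d2 d2D [e eE vde]].
have eta_e : eta p e = 0.
  move: eE => /memv_addP[_ /memv_imgP[w _ ->] [b]]; rewrite (qDbarE Q).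
  move=> /memv_addP[_ /memv_imgP[w' _ ->] [_ /memv_imgP[w'' _ ->] ->] ->].
  by rewrite !linearD /= !ns_eta_phi !addr0.
have d2R : d2 \in RadTM (ns_g NS) iota p by rewrite (qRad_sum Q) (subvP (addvSr _ _)).
have gd2 : g p v d2 = 0.
  by move: d2R; rewrite memv_cap => /andP[_ /orthP]; apply.
have : eta p v * eta p v = 0.
  rewrite {2}vde linearD /= eta_e addr0 [eta p d2]ns_eta_g.
  by rewrite -gformZl -vE.
by move/eqP; rewrite mulf_eq0 orbb => /eqP.
Qed.

Lemma push_P1 X : (forall p, push iota X p \in distD Q p) ->
  push iota (P1 Q X) = (fun p => phi p (push iota X p)).
Proof.
move=> XD; apply/funext => p; rewrite /P1.
have e : daddv_pi (distD Q p) (distDhat Q p) (push iota X p) = push iota X p.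
  by apply: daddv_pi_id (distD_cap p) (XD p).
rewrite push_pull e//.
by apply/(subvP (distD_TM p))/phi_distD.
Qed.

(** The push-forward of [P1 Q X] is phi X, which is differentiable along [iota]; injectivity of the
    tangent map carries this back to M. *)
Lemma diff_field_P1 X p : section_of iota (distD Q) X -> diff_field (P1 Q X) p.
Proof.
move=> [sX XD]; apply: (diff_field_of_push (sub_smooth Hsub)).
  exact: sub_imm Hsub p.
rewrite -/(push iota (P1 Q X)) (push_P1 XD).
apply: (diff_along_endo (sub_smooth Hsub) (@ns_phi_smooth _ _ _ NS)).
apply: (diff_along_push (sub_smooth Hsub)); exact: smooth_diff_field.
Qed.

(** This is phi applied to the Gauss formula, followed by the transversal projection. *)
Lemma Q_nabla_f_h X Y p :
  Qop L (nabla L X Y) p + fop L (h L X Y) p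
  = tr_part L p (phi p (nabla_bar NS iota X (push iota Y) p)).
Proof.
rewrite /Qop /fop /nabla (push_pull (V := fun p => tan_part L p _));
  last exact: tan_part_TM.
by rewrite -tr_partD -linearD tan_tr.
Qed.

Lemma h_P1 X Y p : section_of iota (distD Q) X -> section_of iota (distD Q) Y ->
  h L (P1 Q X) Y p + h L X (P1 Q Y) p
  = 2 *: (Qop L (nabla L X Y) p + fop L (h L X Y) p
          + g p (push iota X p) (push iota Y p) *: xi_tr L p)
    - tr_part L p (phi p (push iota (lie_bracket X Y) p)).
Proof.
move=> sX sY; have [cX XD] := sX; have [cY YD] := sY.
have dX := smooth_diff_field p cX; have dY := smooth_diff_field p cY.
have := nearly_along dX dY; rewrite -(push_P1 XD) -(push_P1 YD).
move=> /(congr1 (tr_part L p)).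
rewrite tr_partD !tr_partB !tr_partZ (tr_partT (push_TM X p)) (tr_partT (push_TM Y p)).
rewrite !scaler0 !subr0.
(* This replaces phi (nabla_Y X) by phi (nabla_X Y) - phi [X, Y]: the origin of the factor 2 and of
   the bracket term. *)
have := nabla_bar_torsion dX dY => /(congr1 (fun v => tr_part L p (phi p v))).
rewrite linearB tr_partB => tors.
(* The nearly Sasakian identity produces h(Y, P1 X), with [Y] as the direction of differentiation;
   the bracket of [P1 X] and [Y] is tangent, so the arguments may be exchanged. *)
have := nabla_bar_torsion (diff_field_P1 p sX) dY => /(congr1 (tr_part L p)).
rewrite tr_partB (tr_partT (push_TM _ p)) => /eqP; rewrite subr_eq0 => /eqP sym.
rewrite Q_nabla_f_h -tors /h /xi_tr.
move=> H; rewrite sym scalerDr scalerA.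
move: H; set a := tr_part L p _; set b := tr_part L p _; set c := tr_part L p _.
set d := tr_part L p _; set e := _ *: _ => H.
rewrite -H.
have alg (a' b' c' d' : TN) : c' + a' = 2 *: b' + (a' - b' + (c' - d')) - (b' - d').
  by apply/rowP => i; rewrite !mxE; ring.
exact: alg.
Qed.

(** As phi maps D into TM, the transversal part of phi v depends only on the Dhat component v'. The
    two equations on the left are thus the tangential and the transversal half of phi v' = 0. *)
Lemma P2_tr_eq0 X p : (P2 Q X p = 0 /\ tr_part L p (phi p (push iota X p)) = 0) <->
  push iota X p \in distD Q p.
Proof.
set v := push iota X p; set v' := daddv_pi (distDhat Q p) (distD Q p) v.
have vT : v \in TM iota p by exact: push_TM.
have vE : daddv_pi (distD Q p) (distDhat Q p) v + v' = v.
  by apply: daddv_pi_add; [exact: distD_cap|rewrite distD_sum].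
have cap' : (distDhat Q p :&: distD Q p = 0)%VS by rewrite capvC distD_cap.
have trE : tr_part L p (phi p v) = tr_part L p (phi p v').
  have t0 := tr_phi_distD (memv_pi (distD Q p) (distDhat Q p) v).
  by rewrite -[in LHS]vE linearD tr_partD [X in X + _]t0 add0r.
split=> [[P20 tr0]|vD].
  have t0 : tan_part L p (phi p v') = 0.
    apply: (pull_eq0 (V := fun p => tan_part L p (phi p
      (daddv_pi (distDhat Q p) (distD Q p) (push iota X p))))) => //.
    exact: tan_part_TM.
  have v'0 : v' = 0.
    apply: phi_distDhat_eq0; first exact: memv_pi.
    by rewrite -[LHS](tan_tr p) t0 -trE tr0 addr0.
  by rewrite -vE v'0 addr0 memv_pi.
have v'0 : v' = 0 by apply: daddv_pi_eq0.
split; last by rewrite tr_phi_distD.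
by rewrite /P2 /pull -/v -/v' v'0 linear0 /tan_part linear0 linear0.
Qed.

End QGCRTheory.
End NearlySasakianAlong.

Unset Implicit Arguments.

Theorem theorem5p2 (R : realType) (n m : nat)
    (Mbar : manifold R n.*2.+1) (NS : nearlySasakian Mbar)
    (M : manifold R m) (iota : M -> Mbar) (Hsub : submanifold iota)
    (L : lightlike (ns_g NS) iota) (Q : QGCR L) :
  integrable_dist iota (distD Q) <->
  (forall X Y : M -> 'rV[R]_m,
     section_of iota (distD Q) X -> section_of iota (distD Q) Y ->
     (forall p : M,
        h L (P1 Q X) Y p + h L X (P1 Q Y) p
        = 2 *: (Qop L (nabla L X Y) p + fop L (h L X Y) p
                + gform (ns_g NS (iota p)) (push iota X p) (push iota Y p)
                  *: xi_tr L p))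
     /\ (forall p : M, P2 Q (lie_bracket X Y) p = 0)).
Proof.
have hE X Y p : section_of iota (distD Q) X -> section_of iota (distD Q) Y ->
    h L (P1 Q X) Y p + h L X (P1 Q Y) p
    = 2 *: (Qop L (nabla L X Y) p + fop L (h L X Y) p
            + gform (ns_g NS (iota p)) (push iota X p) (push iota Y p) *: xi_tr L p)
    <-> tr_part L p (ns_phi NS (iota p) (push iota (lie_bracket X Y) p)) = 0.
  move=> sX sY; rewrite (h_P1 Hsub)//; split=> [/eqP|->]; last by rewrite subr0.
  by rewrite -subr_eq0 addrAC subrr add0r oppr_eq0 => /eqP.
split=> [I X Y sX sY|H X Y sX sY p].
  split=> p; have [P20 tr0] := (P2_tr_eq0 Q (lie_bracket X Y) p).2 (I X Y sX sY p).
    exact/hE.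
  exact: P20.
have [H1 H2] := H X Y sX sY.
apply/(P2_tr_eq0 Q (lie_bracket X Y) p); split; first exact: H2.
exact/hE.
Qed.
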